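(* There is a dynamic-programming algorithm that, given an alphabet $C$ of $n$ characters with frequencies, a blocking scheme, a permitted code length $\mathcal{L}$ and $\epsilon>0$, returns a prefix tree $T$ with $\mathrm{len}(T)\le(1+\epsilon)\mathcal{L}$ and $\Delta(T)\le \mathrm{DOPT}(\mathcal{L})$, and runs in time $O(n^4/\epsilon)$.
   Context: Let $C$ be an alphabet of $n$ characters, each $c\in C$ with a nonnegative integer frequency $\mathrm{freq}(c)$. A prefix tree for $C$ is a rooted binary tree in which every internal node has exactly two children and whose leaves are in bijection with $C$; $d_T(c)$ is the depth of the leaf of $c$ (root has depth $0$). The code length of $T$ is $\mathrm{len}(T)=\sum_{c\in C}\mathrm{freq}(c)\, d_T(c)$. A blocking scheme is a sequence $\langle (w_1,q_1),(w_2,q_2),\dots\rangle$ of positive integer widths $w_j$ and access costs $q_j\ge 0$ (assumed long enough that the quantities below exist). For a character $c$, let $W_T(c)$ be the smallest $h$ with $\sum_{j=1}^h w_j\ge d_T(c)$, and $\Delta_T(c)=\sum_{i\le W_T(c)} q_i$. The decode time of $T$ is $\Delta(T)=\sum_{c\in C}\mathrm{freq}(c)\,\Delta_T(c)$. $\mathrm{DOPT}(\mathcal{L})$ denotes the minimum of $\Delta(T)$ over all prefix trees $T$ with $\mathrm{len}(T)\le\mathcal{L}$.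
   Formalization: The running time is stated as O(n^4/min(1,ε)), since O(n^4/ε) cannot hold uniformly for very large ε (the tree must be written); the guarantees on T are asserted when some prefix tree has len ≤ L, so that DOPT(L) exists; n ≥ 1. *)

(* Defs.v *)
From HB Require Import structures.
From mathcomp Require Import all_boot all_order all_algebra.
From mathcomp Require Import reals.

Set Implicit Arguments.
Unset Strict Implicit.
Unset Printing Implicit Defensive.

Import Order.TTheory GRing.Theory Num.Theory.

Local Open Scope ring_scope.

Inductive btree (C : Type) : Type :=
| Leaf of C
| Node of btree C & btree C.

Fixpoint leaves (C : Type) (T : btree C) : seq C :=
  match T with
  | Leaf c => [:: c]
  | Node l r => leaves l ++ leaves r
  end.

Definition prefix_tree (C : finType) (T : btree C) : Prop :=
  perm_eq (leaves T) (enum C).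

(* Meaningful when c labels a leaf of T (junk value otherwise). *)
Fixpoint depth (C : eqType) (T : btree C) (c : C) : nat :=
  match T with
  | Leaf _ => 0%N
  | Node l r => if c \in leaves l then (depth l c).+1 else (depth r c).+1
  end.

Definition len (C : finType) (freq : C -> nat) (T : btree C) : nat :=
  (\sum_(c : C) freq c * depth T c)%N.

Section Blocking.
Variable R : realType.

(* A finite blocking scheme [:: (w_1, q_1); (w_2, q_2); ...]. *)
Definition scheme := seq (nat * R).

Definition valid_scheme (s : scheme) : Prop :=
  forall p, p \in s -> (0 < p.1)%N /\ 0 <= p.2.

Definition width_upto (s : scheme) (h : nat) : nat :=
  (\sum_(p <- take h s) p.1)%N.

(* "Long enough": W_T(c) exists for every prefix tree T and character c. *)
Definition long_enough (C : finType) (s : scheme) : Prop :=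
  forall T : btree C, prefix_tree T -> forall c : C,
    exists2 h, (h <= size s)%N & (depth T c <= width_upto s h)%N.

(* W_T(c): the least h <= size s whose first h widths add up to at least
   depth T c, and (size s).+1 if there is none. *)
Definition nblocks (C : eqType) (s : scheme) (T : btree C) (c : C) : nat :=
  find (fun h => depth T c <= width_upto s h)%N (iota 0 (size s).+1).

Definition char_decode_time (C : eqType) (s : scheme) (T : btree C) (c : C)
    : R :=
  \sum_(p <- take (nblocks s T c) s) p.2.

Definition decode_time (C : finType) (freq : C -> nat) (s : scheme)
    (T : btree C) : R :=
  \sum_(c : C) (freq c)%:R * char_decode_time s T c.

Definition admissible (C : finType) (freq : C -> nat) (L : R) (T : btree C)
    : Prop :=
  prefix_tree T /\ (len freq T)%:R <= L.

(* v = DOPT(L): the minimum of an empty family does not exist, so no v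
   qualifies when no prefix tree has code length at most L. *)
Definition is_DOPT (C : finType) (freq : C -> nat) (s : scheme) (L v : R)
    : Prop :=
  (exists2 T, admissible freq L T & decode_time freq s T = v) /\
  (forall T, admissible freq L T -> v <= decode_time freq s T).

End Blocking.

(* Machine model: a real RAM in structured form.  The memory consists of
   arrays of natural numbers and arrays of reals, with indirect indexing; the
   array name is a literal of the program text, so a program uses finitely
   many arrays.  Every syntax node evaluated costs one time unit.  Two
   operations are left out on purpose because at unit cost they would make the
   model unreasonably powerful: multiplication on naturals, and any conversion
   from reals to naturals (floor).  No real constants are available besides the
   casts of naturals. *)

Inductive nexp :=
| NLit of nat
| NGet of nat & nexp
| NAdd of nexp & nexp
| NSub of nexp & nexp.

Inductive rexp :=
| RNat of nexp
| RGet of nat & nexp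
| RAdd of rexp & rexp
| RSub of rexp & rexp
| RMul of rexp & rexp
| RDiv of rexp & rexp.

Inductive bexp :=
| BLeN of nexp & nexp
| BLeR of rexp & rexp
| BNot of bexp
| BAnd of bexp & bexp.

Inductive cmd :=
| Skip
| NSet of nat & nexp & nexp
| RSet of nat & nexp & rexp
| Seq of cmd & cmd
| If of bexp & cmd & cmd
| While of bexp & cmd.

Fixpoint ncost (e : nexp) : nat :=
  match e with
  | NLit _ => 1
  | NGet _ i => (ncost i).+1
  | NAdd e1 e2 | NSub e1 e2 => (ncost e1 + ncost e2).+1
  end.

Fixpoint rcost (e : rexp) : nat :=
  match e with
  | RNat e1 => (ncost e1).+1
  | RGet _ i => (ncost i).+1
  | RAdd e1 e2 | RSub e1 e2 | RMul e1 e2 | RDiv e1 e2 =>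
      (rcost e1 + rcost e2).+1
  end.

Fixpoint bcost (b : bexp) : nat :=
  match b with
  | BLeN e1 e2 => (ncost e1 + ncost e2).+1
  | BLeR e1 e2 => (rcost e1 + rcost e2).+1
  | BNot b1 => (bcost b1).+1
  | BAnd b1 b2 => (bcost b1 + bcost b2).+1
  end.

Section Semantics.
Variable R : realType.

Record state := State {
  nmem : nat -> nat -> nat;
  rmem : nat -> nat -> R
}.

Definition upd (V : Type) (M : nat -> nat -> V) (a i : nat) (v : V) :=
  fun a' i' => if (a' == a) && (i' == i) then v else M a' i'.

Fixpoint neval (s : state) (e : nexp) : nat :=
  match e with
  | NLit k => k
  | NGet a i => nmem s a (neval s i)
  | NAdd e1 e2 => (neval s e1 + neval s e2)%N
  | NSub e1 e2 => (neval s e1 - neval s e2)%N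
  end.

Fixpoint reval (s : state) (e : rexp) : R :=
  match e with
  | RNat e1 => (neval s e1)%:R
  | RGet a i => rmem s a (neval s i)
  | RAdd e1 e2 => reval s e1 + reval s e2
  | RSub e1 e2 => reval s e1 - reval s e2
  | RMul e1 e2 => reval s e1 * reval s e2
  | RDiv e1 e2 => reval s e1 / reval s e2
  end.

Fixpoint beval (s : state) (b : bexp) : bool :=
  match b with
  | BLeN e1 e2 => (neval s e1 <= neval s e2)%N
  | BLeR e1 e2 => reval s e1 <= reval s e2
  | BNot b1 => ~~ beval s b1
  | BAnd b1 b2 => beval s b1 && beval s b2
  end.

(* exec c s t s' : started in s, the command c halts in s' after time t. *)
Inductive exec : cmd -> state -> nat -> state -> Prop :=
| ExSkip s : exec Skip s 1 s
| ExNSet a i e s :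
    exec (NSet a i e) s (ncost i + ncost e).+1
      (State (upd (nmem s) a (neval s i) (neval s e)) (rmem s))
| ExRSet a i e s :
    exec (RSet a i e) s (ncost i + rcost e).+1
      (State (nmem s) (upd (rmem s) a (neval s i) (reval s e)))
| ExSeq c1 c2 s1 s2 s3 t1 t2 :
    exec c1 s1 t1 s2 -> exec c2 s2 t2 s3 -> exec (Seq c1 c2) s1 (t1 + t2) s3
| ExIfTrue b c1 c2 s1 s2 t :
    beval s1 b -> exec c1 s1 t s2 -> exec (If b c1 c2) s1 (bcost b + t).+1 s2
| ExIfFalse b c1 c2 s1 s2 t :
    ~~ beval s1 b -> exec c2 s1 t s2 ->
    exec (If b c1 c2) s1 (bcost b + t).+1 s2
| ExWhileFalse b c s :
    ~~ beval s b -> exec (While b c) s (bcost b).+1 s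
| ExWhileTrue b c s1 s2 s3 t1 t2 :
    beval s1 b -> exec c s1 t1 s2 -> exec (While b c) s2 t2 s3 ->
    exec (While b c) s1 (bcost b + t1 + t2).+1 s3.

(* The alphabet is presented to the machine as 0, ..., n-1.  Natural arrays:
   0 holds n and the number of blocks, 1 the frequencies, 2 the widths.  Real
   arrays: 0 holds L and eps, 1 the access costs.  All other cells are 0. *)
Definition input (n : nat) (freq : 'I_n -> nat) (bs : scheme R) (L eps : R)
    : state :=
  State
    (fun a i => match a with
                | 0 => nth 0%N [:: n; size bs] i
                | 1 => nth 0%N [seq freq c | c <- enum 'I_n] i
                | 2 => nth 0%N (unzip1 bs) i
                | _ => 0%N
                end)
    (fun a i => match a with
                | 0 => nth 0 [:: L; eps] i
                | 1 => nth 0 (unzip2 bs) i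
                | _ => 0
                end).

(* Pointer representation of a tree in a heap M: a leaf is a record
   (0, character), an internal node a record (1, left, right). *)
Fixpoint stored (n : nat) (M : nat -> nat) (p : nat) (T : btree 'I_n) : Prop :=
  match T with
  | Leaf c => M p = 0%N /\ M p.+1 = c
  | Node l r => [/\ M p = 1%N, stored M (M p.+1) l & stored M (M p.+2) r]
  end.

(* The output tree lives in natural array 4; cell 0 of natural array 3 holds
   the address of its root. *)
Definition output (n : nat) (s : state) (T : btree 'I_n) : Prop :=
  stored (nmem s 4) (nmem s 3 0) T.

End Semantics.

(* Main.v *)
Require Import Defs.
From HB Require Import structures.
From mathcomp Require Import all_boot all_order all_algebra.
From mathcomp Require Import reals boolp.
From mathcomp Require Import ring lra zify.

Set Implicit Arguments.
Unset Strict Implicit.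
Unset Printing Implicit Defensive.

Import Order.TTheory GRing.Theory Num.Theory.

Local Open Scope ring_scope.

(** The code length and the decode time of a tree are both sums over its levels:
    descending from depth d to d+1 costs 1, respectively the price of a possible
    new block, times the total frequency of the characters below depth d.  That
    total is at least the sum of the v smallest frequencies, where v is the
    number of characters below depth d, and a tree with the same profile attains
    this bound on every level.  So an optimal profile is found by dynamic
    programming over (depth, characters left, nodes on the level, remaining code
    length), placing characters in order of decreasing frequency; each state has
    two successors: make the next node of the level a leaf, or turn all its
    remaining nodes into internal nodes.

    A tree has fewer than n levels, hence rounding every such sum up to a
    multiple of eps L / n inflates the code length by at most eps L.  In units
    of eps L / n the budget is floor(n/eps) + n, so there are O(n^3 (n/eps + n))
    states. *)

(** * Forests and their levels *)

Section Forests.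
Variable C : Type.
Implicit Types (T : btree C) (F : seq (btree C)).

Definition is_leaf T : bool := if T is Leaf _ then true else false.

Definition forest_leaves F : seq C := flatten (map (@leaves C) F).

Definition children F : seq (btree C) :=
  flatten [seq if T is Node l r then [:: l; r] else [::] | T <- F].

Fixpoint pair_up F : seq (btree C) :=
  if F is T1 :: T2 :: F' then Node T1 T2 :: pair_up F' else [::].

Lemma leaves_gt0 T : (0 < size (leaves T))%N.
Proof. by elim: T => //= l IHl r IHr; rewrite size_cat addn_gt0 IHl. Qed.

Lemma forest_leaves_cons T F :
  forest_leaves (T :: F) = leaves T ++ forest_leaves F.
Proof. by []. Qed.

Lemma children_leaf c F : children (Leaf c :: F) = children F.
Proof. by []. Qed.

Lemma children_node l r F : children (Node l r :: F) = [:: l, r & children F].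
Proof. by []. Qed.

Lemma leq_size_forest_leaves F : (size F <= size (forest_leaves F))%N.
Proof.
elim: F => //= T F IH; rewrite forest_leaves_cons size_cat.
by rewrite -add1n leq_add ?leaves_gt0.
Qed.

Lemma size_forest_leaves F :
  size (forest_leaves F)
  = (count is_leaf F + size (forest_leaves (children F)))%N.
Proof.
elim: F => //= -[c|l r] F IH; rewrite forest_leaves_cons size_cat IH /=.
  by rewrite children_leaf addnA.
by rewrite children_node !forest_leaves_cons !size_cat; lia.
Qed.

Lemma size_children F : size (children F) = (size F - count is_leaf F).*2.
Proof.
elim: F => // -[c|l r] F IH; first by rewrite children_leaf IH.
by rewrite children_node /= IH subSn ?count_size.
Qed.

(* The number of leaves minus the number of trees bounds the depth. *)
Lemma excess_children F u : (size (forest_leaves F) <= size F + u.+1)%N ->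
  (size (forest_leaves (children F)) <= size (children F) + u)%N.
Proof.
have := count_size is_leaf F; have := size_forest_leaves F.
case: (posnP (size (children F))) => [/size0nil -> //|].
by rewrite size_children; lia.
Qed.

Lemma children_nil F :
  (size (forest_leaves F) <= size F)%N -> children F = [::].
Proof.
move=> le_leaves; apply: size0nil.
have := leq_size_forest_leaves (children F).
have := size_forest_leaves F; have := count_size is_leaf F.
by rewrite size_children; lia.
Qed.

Lemma size_pair_up F m : size F = m.*2 -> size (pair_up F) = m.
Proof. by elim: m F => [|m IH] [|T1 [|T2 F]] //= [/IH->]. Qed.

Lemma forest_leaves_pair_up F m : size F = m.*2 ->
  forest_leaves (pair_up F) = forest_leaves F.
Proof.
elim: m F => [|m IH] [|T1 [|T2 F]] //= [/IH eqF].
by rewrite !forest_leaves_cons eqF /= catA.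
Qed.

Lemma children_pair_up F m : size F = m.*2 -> children (pair_up F) = F.
Proof.
by elim: m F => [|m IH] [|T1 [|T2 F]] //= [/IH eqF]; rewrite children_node eqF.
Qed.

End Forests.

Lemma subseq_children (C : eqType) (F : seq (btree C)) :
  subseq (forest_leaves (children F)) (forest_leaves F).
Proof.
elim: F => //= -[c|l r] F IH.
  by rewrite forest_leaves_cons; apply: (subseq_trans IH); apply: subseq_cons.
by rewrite children_node !forest_leaves_cons /= catA; apply: cat_subseq.
Qed.

Section Weights.
Variables (R : comPzRingType) (C : Type) (freq : C -> nat).
Implicit Types (T : btree C) (F : seq (btree C)) (phi : nat -> R).

Fixpoint tree_weight phi d T : R :=
  match T with
  | Leaf c => (freq c)%:R * phi d
  | Node l r => tree_weight phi d.+1 l + tree_weight phi d.+1 r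
  end.

Definition forest_weight phi d F : R := \sum_(T <- F) tree_weight phi d T.

Definition forest_freq F : nat := \sum_(c <- forest_leaves F) freq c.

Lemma forest_weight_nil phi d : forest_weight phi d [::] = 0.
Proof. exact: big_nil. Qed.

Lemma forest_weight_cons phi d T F :
  forest_weight phi d (T :: F) = tree_weight phi d T + forest_weight phi d F.
Proof. exact: big_cons. Qed.

Lemma forest_freq_cons T F :
  forest_freq (T :: F) = (\sum_(c <- leaves T) freq c + forest_freq F)%N.
Proof. by rewrite /forest_freq forest_leaves_cons big_cat. Qed.

(* Summation by parts along the levels. *)
Lemma forest_weight_children phi d F :
  forest_weight phi d F
  = phi d * ((forest_freq F)%:R - (forest_freq (children F))%:R)
    + forest_weight phi d.+1 (children F).
Proof.
elim: F => [|[c|l r] F IH].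
- by rewrite !forest_weight_nil subrr mulr0 addr0.
- rewrite children_leaf forest_weight_cons forest_freq_cons IH big_seq1 natrD.
  by rewrite /=; ring.
- rewrite children_node !forest_weight_cons !forest_freq_cons IH /= big_cat /=.
  by rewrite !natrD; ring.
Qed.

Lemma forest_weight_pair_up phi d F m : size F = m.*2 ->
  forest_weight phi d (pair_up F) = forest_weight phi d.+1 F.
Proof.
move=> sizeF; rewrite forest_weight_children (children_pair_up sizeF).
by rewrite /forest_freq (forest_leaves_pair_up sizeF) subrr mulr0 add0r.
Qed.

End Weights.

Lemma tree_weightE (R : comPzRingType) (C : eqType) (freq : C -> nat)
    (phi : nat -> R) (d : nat) (T : btree C) : uniq (leaves T) ->
  tree_weight freq phi d T
  = \sum_(c <- leaves T) (freq c)%:R * phi (d + depth T c)%N.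
Proof.
elim: T d => [c|l IHl r IHr] d /=; first by rewrite big_seq1 addn0.
rewrite cat_uniq big_cat => /and3P[uniq_l /hasPn disj uniq_r] /=.
rewrite IHl // IHr //; congr (_ + _); apply: eq_big_seq => c c_in.
  by rewrite c_in addSnnS.
by rewrite (negPf (disj c c_in)) addSnnS.
Qed.

Section LevelSums.
Variables (R : realDomainType) (C : Type).
Implicit Types (F : seq (btree C)) (a : nat -> nat -> R).

Definition size_below F : nat := size (forest_leaves (children F)).

Fixpoint level_sum a d u F : R :=
  if u is u'.+1 then
    a d (size_below F) + level_sum a d.+1 u' (children F)
  else 0.

Lemma level_sum_nil a d u : (forall d, a d 0%N = 0) ->
  level_sum a d u [::] = 0.
Proof. by move=> a0; elim: u d => //= u IH d; rewrite a0 IH addr0. Qed.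

Lemma level_sum_ge0 a d u F : (forall d v, 0 <= a d v) ->
  0 <= level_sum a d u F.
Proof. by move=> a_ge0; elim: u d F => //= u IH d F; rewrite addr_ge0. Qed.

Lemma level_sum_le_affine a a' k e d u F :
  (forall d v, a d v <= k * a' d v + e) ->
  level_sum a d u F <= k * level_sum a' d u F + e * u%:R.
Proof.
move=> le_aa'; elim: u d F => [|u IH] d F /=; first by rewrite !mulr0 addr0.
have := IH d.+1 (children F); have := le_aa' d (size_below F).
by rewrite -natr1; lra.
Qed.

End LevelSums.

(** * The lightest characters *)

Lemma sum_ord_le_sum_uniq (h : nat -> nat) (s : seq nat) :
  {homo h : x y / (x <= y)%N} -> uniq s ->
  (\sum_(i < size s) h i <= \sum_(i <- s) h i)%N.
Proof.
move=> h_mono uniq_s; rewrite -(perm_big _ (permEl (perm_sort leq s))).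
have sorted_s : sorted ltn (sort leq s).
  by rewrite ltn_sorted_uniq_leq sort_uniq uniq_s (sort_sorted leq_total).
rewrite (big_nth 0) big_mkord size_sort; apply: leq_sum => i _; apply: h_mono.
case: i => i /=; elim: i => [//|i IH] i_lt.
apply: leq_ltn_trans (IH (ltnW i_lt)) _.
by apply: (sorted_ltn_nth ltn_trans) => //; rewrite inE size_sort // ltnW.
Qed.

Section LightestCharacters.
Variables (C : finType) (freq : C -> nat) (n : nat) (nth_char : nat -> C).

Definition least_freq (v : nat) : nat := \sum_(k < v) freq (nth_char k).

Lemma least_freq0 : least_freq 0 = 0%N.
Proof. exact: big_ord0. Qed.

Lemma least_freqS v : least_freq v.+1 = (least_freq v + freq (nth_char v))%N.
Proof. exact: big_ord_recr. Qed.

Hypothesis nth_char_sorted :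
  forall x y, (x <= y < n)%N -> (freq (nth_char x) <= freq (nth_char y))%N.
Hypothesis nth_char_perm :
  perm_eq [seq nth_char k | k <- iota 0 n] (enum C).

Lemma least_freq_le (X : seq C) : uniq X ->
  (least_freq (size X) <= \sum_(c <- X) freq c)%N.
Proof.
move=> uniqX; pose chars := [seq nth_char k | k <- iota 0 n].
have mem_chars c : c \in chars by rewrite (perm_mem nth_char_perm) mem_enum.
have size_chars : size chars = n by rewrite size_map size_iota.
have idx_lt c : (index c chars < n)%N by rewrite -size_chars index_mem.
have idxK : cancel (index^~ chars) nth_char.
  move=> c; have := nth_index c (mem_chars c).
  by rewrite (nth_map 0) ?size_iota ?nth_iota ?idx_lt.
pose h k := freq (nth_char (minn k n.-1)).
have h_lt k : (k < n)%N -> h k = freq (nth_char k).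
  by move=> k_lt; rewrite /h (minn_idPl _) //; lia.
have sizeX : (size X <= n)%N.
  by rewrite -size_chars; apply: uniq_leq_size => // c _.
have h_mono : {homo h : x y / (x <= y)%N}.
  move=> x y le_xy; have [n0|n_gt0] := posnP n; first by rewrite /h n0 !minn0.
  by apply: nth_char_sorted; lia.
have uniq_idx : uniq [seq index c chars | c <- X].
  by rewrite (map_inj_uniq (can_inj idxK)).
have := sum_ord_le_sum_uniq h_mono uniq_idx; rewrite big_map size_map.
under [in X in (_ <= X)%N]eq_bigr do rewrite h_lt // idxK.
rewrite (eq_bigr (fun k : 'I_(size X) => freq (nth_char k))) // => k _.
by rewrite h_lt // (leq_trans (ltn_ord k)).
Qed.

Variables (R : realDomainType) (Q price : nat -> R).
Hypothesis Q_step : forall d, Q d.+1 = Q d + price d.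
Hypothesis price_ge0 : forall d, 0 <= price d.

Definition level_cost (d v : nat) : R := (least_freq v)%:R * price d.

Lemma level_sum_le_weight d u (F : seq (btree C)) :
  uniq (forest_leaves F) -> (size (forest_leaves F) <= size F + u)%N ->
  Q d * (forest_freq freq F)%:R + level_sum level_cost d u F
  <= forest_weight freq Q d F.
Proof.
elim: u d F => [|u IH] d F uniqF excess; rewrite forest_weight_children /=.
  rewrite children_nil; last by rewrite addn0 in excess.
  by rewrite forest_weight_nil /forest_freq /forest_leaves big_nil; lra.
have uniq_ch := subseq_uniq (subseq_children F) uniqF.
have := IH d.+1 _ uniq_ch (excess_children excess).
have : (least_freq (size_below F))%:R
         <= (forest_freq freq (children F))%:R :> R.
  by rewrite ler_nat least_freq_le.
by move=> /(ler_wpM2r (price_ge0 d)); rewrite Q_step /level_cost; lra.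
Qed.

End LightestCharacters.

(** * The dynamic program *)

Section DynamicProgram.
Variables (R : realDomainType) (C : finType) (freq : C -> nat).
Variables (nth_char : nat -> C) (units : nat -> nat) (price : nat -> R).
Implicit Types (F : seq (btree C)) (u d v j l : nat).

Local Notation least_freq := (least_freq freq nth_char).
Local Notation level_cost := (level_cost freq nth_char price).

Definition plan : Type := option (R * seq (btree C)).

Definition plan_cost (p : plan) : R := oapp fst 0 p.

Definition costs_at_most (p : plan) (c : R) : bool :=
  if p is Some (c', _) then c' <= c else false.

Definition cheapest (p q : plan) : plan :=
  match p, q with
  | Some (c, _), Some (c', _) => if c <= c' then p else q
  | None, _ => q
  | _, None => p
  end.

Definition add_leaf (k : nat) (p : plan) : plan :=
  omap (fun '(c, F) => (c, Leaf (nth_char k) :: F)) p.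

Definition add_level (d v : nat) (p : plan) : plan :=
  omap (fun '(c, F) => (c + level_cost d v, pair_up F)) p.

Definition can_descend u v j l : bool :=
  [&& 0 < u, j.*2 <= v & units v <= l]%N.

(* In state (u, d, v, j, l) the depth is d, at most u levels remain below it,
   the v least frequent characters are still to be placed, j nodes of the
   current level are undecided and l units of code length may still be spent. *)
Fixpoint dp (u d : nat) : nat -> nat -> nat -> plan :=
  fix dp_level (v j l : nat) {struct v} : plan :=
    match v, j with
    | 0, 0 => Some (0, [::])
    | v'.+1, j'.+1 =>
        cheapest (add_leaf v' (dp_level v' j' l))
          (if can_descend u v j l then
             if u is u'.+1 then
               add_level d v (dp u' d.+1 v j.*2 (l - units v)%N)
             else None
           else None)
    | _, _ => None
    end.

Lemma dpSS u d v j l :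
  dp u d v.+1 j.+1 l
  = cheapest (add_leaf v (dp u d v j l))
      (if can_descend u v.+1 j.+1 l then
         add_level d v.+1 (dp u.-1 d.+1 v.+1 j.+1.*2 (l - units v.+1))
       else None).
Proof. by case: u. Qed.

Variant dp_spec u d v j l : plan -> Prop :=
| DpInfeasible : dp_spec u d v j l None
| DpDone of v = 0%N & j = 0%N : dp_spec u d v j l (Some (0, [::]))
| DpLeaf v' j' c F of v = v'.+1 & j = j'.+1 & dp u d v' j' l = Some (c, F) :
    dp_spec u d v j l (Some (c, Leaf (nth_char v') :: F))
| DpDescend u' c F of u = u'.+1 & (0 < j)%N & (j.*2 <= v)%N & (units v <= l)%N
    & dp u' d.+1 v j.*2 (l - units v) = Some (c, F) :
    dp_spec u d v j l (Some (c + level_cost d v, pair_up F)).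

Lemma dpP u d v j l : dp_spec u d v j l (dp u d v j l).
Proof.
case: v => [|v]; case: j => [|j]; try by case: u => *; constructor.
rewrite dpSS; case eq_leaf: (dp u d v j l) => [[c F]|]; last first.
  case: ifP => [/and3P[u_gt0 le_jv le_unit]|_]; last exact: DpInfeasible.
  case: u u_gt0 eq_leaf => // u _ _.
  case eq_desc: dp => [[c' F']|]; last exact: DpInfeasible.
  exact: DpDescend eq_desc.
case: ifP => [/and3P[u_gt0 le_jv le_unit]|_]; last exact: DpLeaf eq_leaf.
case: u u_gt0 eq_leaf => // u _ eq_leaf.
case eq_desc: dp => [[c' F']|] /=; last exact: DpLeaf eq_leaf.
by case: ifP => _; [exact: DpLeaf eq_leaf | exact: DpDescend eq_desc].
Qed.

Inductive built :
    nat -> nat -> nat -> nat -> nat -> R -> seq (btree C) -> Prop :=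
| BuiltDone u d l : built u d 0 0 l 0 [::]
| BuiltLeaf u d v j l c F :
    built u d v j l c F -> built u d v.+1 j.+1 l c (Leaf (nth_char v) :: F)
| BuiltDescend u d v j l c F :
    (0 < j)%N -> (j.*2 <= v)%N -> (units v <= l)%N ->
    built u d.+1 v j.*2 (l - units v) c F ->
    built u.+1 d v j l (c + level_cost d v) (pair_up F).

Lemma dp_built u d v j l c F :
  dp u d v j l = Some (c, F) -> built u d v j l c F.
Proof.
have [k] := ubnP (u + v)%N; elim: k u d v j l c F => // k IH u d v j l c F lt_k.
case: dpP => //.
- by move=> -> -> [<- <-]; constructor.
- move=> v' j' c' F' eq_v -> dpF' [<- <-].
  by rewrite eq_v; constructor; apply: IH dpF'; lia.
- move=> u' c' F' eq_u j_gt0 le_jv le_unit dpF' [<- <-].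
  by rewrite eq_u; constructor=> //; apply: IH dpF'; lia.
Qed.

Lemma costs_at_most_cheapest_l p q c :
  costs_at_most p c -> costs_at_most (cheapest p q) c.
Proof.
case: p q => [[a F]|] [[b G]|] //= le_ac; case: leP => //= lt_ba.
exact: le_trans (ltW lt_ba) le_ac.
Qed.

Lemma costs_at_most_cheapest_r p q c :
  costs_at_most q c -> costs_at_most (cheapest p q) c.
Proof.
by case: p q => [[a F]|] [[b G]|] //= le_bc; case: leP => //= /le_trans; apply.
Qed.

Lemma dp_optimal u d v j l c F :
  built u d v j l c F -> costs_at_most (dp u d v j l) c.
Proof.
elim=> {u d v j l c F}
  [u d l|u d v j l c F _ IH|u d v j l c F j_gt0 le_jv le_unit _ IH].
- by case: u => /=.
- by rewrite dpSS; apply: costs_at_most_cheapest_l; case: dp IH => [[]|].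
- case: v j j_gt0 le_jv le_unit IH => [|v] [|j] // _ le_jv le_unit IH.
  rewrite dpSS; apply: costs_at_most_cheapest_r.
  rewrite /can_descend le_jv le_unit /=.
  by case: dp IH => [[c' F']|] //=; rewrite lerD2r.
Qed.

Lemma built_size u d v j l c F : built u d v j l c F -> size F = j.
Proof. by elim=> //= *; [congr _.+1 | apply: size_pair_up]. Qed.

Lemma dp_size u d v j l c F : dp u d v j l = Some (c, F) -> size F = j.
Proof. by move/dp_built/built_size. Qed.

Lemma built_leaves u d v j l c F : built u d v j l c F ->
  perm_eq (forest_leaves F) [seq nth_char k | k <- iota 0 v].
Proof.
elim=> {u d v j l c F} // [u d v j l c F _ IH|u d v j l c F _ _ _ bF IH].
  rewrite forest_leaves_cons -addn1 iotaD map_cat perm_sym perm_catC /=.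
  by rewrite perm_cons perm_sym.
by rewrite (forest_leaves_pair_up (built_size bF)).
Qed.

Lemma built_weight (Q : nat -> R) u d v j l c F :
  (forall d, Q d.+1 = Q d + price d) -> built u d v j l c F ->
  forest_weight freq Q d F = Q d * (least_freq v)%:R + c.
Proof.
move=> Q_step; elim=> {u d v j l c F}
  [u d l|u d v j l c F _ IH|u d v j l c F _ _ _ bF IH].
- by rewrite forest_weight_nil least_freq0 mulr0 addr0.
- by rewrite forest_weight_cons IH least_freqS natrD /=; ring.
- rewrite (forest_weight_pair_up _ _ _ (built_size bF)) IH Q_step.
  by rewrite /level_cost; ring.
Qed.

Lemma built_length (delta : R) (N : nat) u d v j l c F : 0 <= delta ->
  (forall v, (units v <= N)%N -> (least_freq v)%:R <= delta * (units v)%:R) ->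
  built u d v j l c F -> (l <= N)%N ->
  forest_weight freq (fun d => d%:R) d F
  <= d%:R * (least_freq v)%:R + delta * l%:R.
Proof.
move=> delta_ge0 le_units; elim=> {u d v j l c F}
  [u d l|u d v j l c F _ IH|u d v j l c F _ _ le_unit bF IH] le_lN.
- by rewrite forest_weight_nil least_freq0 mulr0 add0r mulr_ge0.
- by rewrite forest_weight_cons least_freqS natrD /=; have := IH le_lN; lra.
- rewrite (forest_weight_pair_up _ _ _ (built_size bF)).
  have := IH (leq_trans (leq_subr _ _) le_lN); rewrite -natr1 (natrB _ le_unit).
  by have := le_units v (leq_trans le_unit le_lN); lra.
Qed.

Lemma built_add_leaves a u d v j l c F : built u d v j l c F ->
  exists F', built u d (a + v) (a + j) l c F'.
Proof.
move=> bF; elim: a => [|a [F' bF']]; first by exists F.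
by exists (Leaf (nth_char (a + v)) :: F'); rewrite !addSn; constructor.
Qed.

(* Moving the leaves of every level to its front and relabelling them in order
   of decreasing frequency turns a forest into a built one. *)
Lemma built_of_forest u d F l :
  (size (forest_leaves F) <= size F + u)%N ->
  level_sum (fun _ v => (units v)%:R) d u F <= l%:R :> R ->
  exists F', built u d (size (forest_leaves F)) (size F) l
               (level_sum level_cost d u F) F'.
Proof.
have sum_nil d' u' : level_sum level_cost d' u' (@nil (btree C)) = 0.
  by apply: level_sum_nil => d''; rewrite /level_cost least_freq0 mul0r.
elim: u d F l => [|u IH] d F l excess len_le.
  have eq_size : size (forest_leaves F) = size F.
    apply/eqP; rewrite eqn_leq leq_size_forest_leaves andbT.
    by rewrite -(addn0 (size F)).
  have [F' bF'] := built_add_leaves (size F) (BuiltDone 0 d l).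
  by exists F'; move: bF'; rewrite eq_size !addn0.
have le_count := count_size (@is_leaf C) F.
rewrite size_forest_leaves -[size F](subnKC le_count).
have [no_child|child] := posnP (size F - count (@is_leaf C) F).
  have ch_nil : children F = [::].
    by apply: size0nil; rewrite size_children no_child.
  rewrite ch_nil no_child /= /size_below ch_nil sum_nil addr0 /level_cost.
  rewrite least_freq0 mul0r.
  exact: built_add_leaves (BuiltDone _ _ _).
move: len_le => /=; rewrite -/(size_below F).
set rest := level_sum _ _ _ _ => len_le.
have rest_ge0 : 0 <= rest by apply: level_sum_ge0.
have le_unit : (units (size_below F) <= l)%N.
  by rewrite -(ler_nat R); lra.
have [||F' bF'] := IH d.+1 (children F) (l - units (size_below F))%N.
- exact: excess_children.
- by rewrite natrB // lerBrDl.
rewrite size_children in bF'; rewrite addrC.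
apply: built_add_leaves (BuiltDescend child _ le_unit bF').
by rewrite -size_children leq_size_forest_leaves.
Qed.

End DynamicProgram.

(** * Block prices *)

Lemma find_leq_iota b m : find (leq b) (iota 0 m) = minn b m.
Proof.
elim: m => [|m IH]; first by rewrite minn0.
rewrite -addn1 iotaD add0n find_cat size_iota IH has_find IH size_iota /=.
by do ?case: ifP; lia.
Qed.

Lemma big_take_succ (V T : Type) (idx : V) (op : Monoid.law idx) (F : T -> V)
    (s : seq T) (h : nat) :
  \big[op/idx]_(x <- take h.+1 s) F x
  = op (\big[op/idx]_(x <- take h s) F x) (nth idx (map F s) h).
Proof.
elim: s h => [|x s IH] [|h] /=; rewrite ?big_nil ?Monoid.mulm1 //.
  by rewrite take0 big_seq1 Monoid.mul1m.
by rewrite !big_cons IH Monoid.mulmA.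
Qed.

Section Blocks.
Variables (R : realType) (bs : scheme R).
Hypothesis bs_valid : valid_scheme bs.

Definition block_cost (d : nat) : R :=
  \sum_(p <- take (find (fun h => d <= width_upto bs h)%N
                        (iota 0 (size bs).+1)) bs) p.2.

Fixpoint blocks_used (d : nat) : nat :=
  if d is d'.+1 then
    if (width_upto bs (blocks_used d') <= d')%N then (blocks_used d').+1
    else blocks_used d'
  else 0%N.

Definition level_price (d : nat) : R :=
  if (width_upto bs (blocks_used d) <= d)%N
  then nth 0 (unzip2 bs) (blocks_used d) else 0.

Lemma width_upto0 : width_upto bs 0 = 0%N.
Proof. by rewrite /width_upto take0 big_nil. Qed.

Lemma width_uptoS h :
  width_upto bs h.+1 = (width_upto bs h + nth 0 (unzip1 bs) h)%N.
Proof. exact: big_take_succ. Qed.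

Lemma nth_width_gt0 h : (h < size bs)%N -> (0 < nth 0 (unzip1 bs) h)%N.
Proof.
move=> lt_h; rewrite (nth_map (0%N, 0)) //.
by have [] := bs_valid (mem_nth (0%N, 0) lt_h).
Qed.

Lemma width_upto_mono h h' : (h <= h' <= size bs)%N ->
  (width_upto bs h + (h' - h) <= width_upto bs h')%N.
Proof.
elim: h' => [|h' IH]; first by rewrite leqn0 => /andP[/eqP-> _]; rewrite addn0.
move=> /andP[le_hh' le_h'].
case: (ltngtP h h'.+1) le_hh' => // [lt_hh' _|-> _]; last first.
  by rewrite subnn addn0.
have := IH (introT andP (conj lt_hh' (ltnW le_h'))).
by have := nth_width_gt0 le_h'; rewrite width_uptoS; lia.
Qed.

Lemma leq_width_upto d h : (h <= size bs)%N ->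
  (d <= width_upto bs h)%N = (blocks_used d <= h)%N.
Proof.
elim: d h => [|d IH] h le_h //=.
set b := blocks_used d in IH *.
have [le_bh|lt_hb] := leqP b h; last by have := IH h le_h; case: ifP; lia.
have := width_upto_mono (introT andP (conj le_bh le_h)).
have := IH b (leq_trans le_bh le_h); rewrite leqnn => le_dW le_WW.
have [eq_bh|ne_bh] := eqVneq b h; first by rewrite -eq_bh; case: ifP; lia.
by case: ifP; lia.
Qed.

Lemma block_costE d :
  block_cost d = \sum_(p <- take (blocks_used d) bs) p.2.
Proof.
rewrite /block_cost (@eq_in_find _ _ (leq (blocks_used d))); last first.
  by move=> h; rewrite mem_iota ltnS /=; apply: leq_width_upto.
by rewrite find_leq_iota take_min [take _.+1 bs]take_oversize.
Qed.

Lemma block_cost0 : block_cost 0 = 0.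
Proof. by rewrite block_costE take0 big_nil. Qed.

Lemma block_costS d : block_cost d.+1 = block_cost d + level_price d.
Proof.
rewrite !block_costE /level_price /=; case: ifP => _; last by rewrite addr0.
exact: big_take_succ.
Qed.

Lemma level_price_ge0 d : 0 <= level_price d.
Proof.
rewrite /level_price; case: ifP => // _.
have [lt_b|ge_b] := ltnP (blocks_used d) (size bs); last first.
  by rewrite nth_default // size_map.
rewrite (nth_map (0%N, 0)) //.
by case: (bs_valid (mem_nth (0%N, 0) lt_b)).
Qed.

End Blocks.

(* A decode time depends on the tree only through the numbers of blocks read,
   and these are bounded. *)
Lemma exists_DOPT (R : realType) (C : finType) (freq : C -> nat)
    (bs : scheme R) (L : R) :
  (exists T0, admissible freq L T0) -> exists v, is_DOPT freq bs L v.
Proof.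
move=> [T0 admT0].
have nblocks_lt (T : btree C) c : (nblocks bs T c < (size bs).+2)%N.
  have := find_size (fun h => depth T c <= width_upto bs h)%N
                    (iota 0 (size bs).+1).
  by rewrite size_iota.
pose blocks T : {ffun C -> 'I_(size bs).+2} :=
  [ffun c => Ordinal (nblocks_lt T c)].
pose time (b : {ffun C -> 'I_(size bs).+2}) : R :=
  \sum_c (freq c)%:R * \sum_(p <- take (b c) bs) p.2.
have decode_timeE T : decode_time freq bs T = time (blocks T).
  by apply: eq_bigr => c _; rewrite ffunE.
pose attained b := `[< exists2 T, admissible freq L T & blocks T = b >].
have att0 : attained (blocks T0) by apply/asboolP; exists T0.
case: (Order.TotalTheory.arg_minP time att0) => b /asboolP[T admT eq_b] min_b.
exists (time b); split; first by exists T => //; rewrite decode_timeE eq_b.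
move=> T' admT'; rewrite decode_timeE; apply: min_b.
by apply/asboolP; exists T'.
Qed.

(** * Rounding *)

Section Rounding.
Variables (R : realFieldType) (delta : R) (B : nat).
Implicit Types (x : R) (m : nat).

Definition round_step x m : nat := if x <= m%:R * delta then m else m.+1.

(* ceil (x / delta) truncated at B + 1; unlike the quotient this is meaningful
   for delta = 0. *)
Definition round_up x : nat := iter B.+1 (round_step x) 0%N.

Lemma round_up_leS x : (round_up x <= B.+1)%N.
Proof.
rewrite /round_up; elim: B.+1 => //= k; rewrite /round_step.
by case: ifP => _; lia.
Qed.

Lemma round_up_le x m : x <= m%:R * delta -> (round_up x <= m)%N.
Proof.
rewrite /round_up => le_xm; elim: B.+1 => //= k; rewrite {2}/round_step.
case: ifPn => // gt_x; rewrite leq_eqVlt => /predU1P[eq_m|//].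
by rewrite eq_m le_xm in gt_x.
Qed.

Lemma le_round_up x : (round_up x <= B)%N -> x <= delta * (round_up x)%:R.
Proof.
rewrite /round_up -ltnS mulrC; elim: B.+1 => //= k IH.
rewrite /round_step; case: ifPn => // /negP gt_x lt_k.
by case: gt_x; apply: IH.
Qed.

Lemma round_up0 : round_up 0 = 0%N.
Proof. by apply/eqP; rewrite -leqn0 round_up_le // mul0r. Qed.

Lemma round_up_le_div x : 0 < delta -> 0 <= x ->
  (round_up x)%:R <= delta^-1 * x + 1.
Proof.
move=> delta_gt0 x_ge0; case eq_round: (round_up x) => [|m].
  by rewrite addr_ge0 // mulr_ge0 // invr_ge0 ltW.
rewrite -natr1 lerD2r mulrC ler_pdivlMr // leNgt; apply/negP.
by move=> /ltW /round_up_le; rewrite eq_round ltnn.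
Qed.

End Rounding.

(** * Ranking by frequency *)

Section Ranking.
Variables (n : nat) (freq : 'I_n -> nat) (o0 : 'I_n).
Implicit Types c : 'I_n.

Definition before (c' c : 'I_n) : bool :=
  (freq c' <= freq c)%N && ~~ ((freq c <= freq c')%N && (c <= c')%N).

Definition rank c : nat := \sum_(c' < n) before c' c.

Lemma rankE c : rank c = #|[pred c' | before c' c]|.
Proof. by rewrite -sum1_card big_mkcond. Qed.

Lemma rank_before c c' : before c c' -> (rank c < rank c')%N.
Proof.
move=> lt_cc'; rewrite !rankE; apply: proper_card; apply/properP; split.
  by apply/subsetP => x; rewrite !inE; move: lt_cc'; rewrite /before; lia.
by exists c; rewrite !inE // /before; lia.
Qed.

Lemma rank_lt c : (rank c < n)%N.
Proof.
rewrite rankE -[X in (_ < X)%N]card_ord; apply: proper_card.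
apply/properP; split; first exact/subsetP.
by exists c; rewrite // inE /before; lia.
Qed.

Definition rank_ord c : 'I_n := Ordinal (rank_lt c).

Lemma rank_ord_inj : injective rank_ord.
Proof.
move=> c c' /(congr1 val) /= eq_rank; apply: val_inj => /=; apply/eqP.
have := @rank_before c c'; have := @rank_before c' c; rewrite eq_rank ltnn.
by rewrite /before; lia.
Qed.

Definition by_freq (k : nat) : 'I_n :=
  if insub k is Some o then invF rank_ord_inj o else o0.

Lemma by_freqK k : (k < n)%N -> rank (by_freq k) = k.
Proof.
move=> lt_k; rewrite /by_freq insubT.
by have /(congr1 val) := f_invF rank_ord_inj (Ordinal lt_k).
Qed.

Lemma rankK : cancel rank by_freq.
Proof.
by move=> c; apply: rank_ord_inj; apply: val_inj; rewrite /= by_freqK ?rank_lt.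
Qed.

Lemma by_freq_sorted x y : (x <= y < n)%N ->
  (freq (by_freq x) <= freq (by_freq y))%N.
Proof.
move=> lt_yn; rewrite leqNgt; apply/negP => lt_freq.
have : before (by_freq y) (by_freq x) by rewrite /before; lia.
by move/rank_before; rewrite !by_freqK; lia.
Qed.

Lemma by_freq_perm : perm_eq [seq by_freq k | k <- iota 0 n] (enum 'I_n).
Proof.
apply: uniq_perm; rewrite ?enum_uniq //.
  rewrite map_inj_in_uniq ?iota_uniq // => x y.
  by rewrite !mem_iota => lt_x lt_y /(congr1 rank); rewrite !by_freqK.
move=> c; rewrite mem_enum inE; apply/mapP; exists (rank c).
  by rewrite mem_iota rank_lt.
by rewrite rankK.
Qed.

End Ranking.

(** * The approximation guarantee *)

Section Approximation.
Variables (R : realType) (C : finType) (freq : C -> nat) (bs : scheme R).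
Variables (n : nat) (nth_char : nat -> C) (L eps : R).
Hypotheses (n_gt0 : (0 < n)%N) (bs_valid : valid_scheme bs) (eps_gt0 : 0 < eps).
Hypothesis nth_char_sorted :
  forall x y, (x <= y < n)%N -> (freq (nth_char x) <= freq (nth_char y))%N.
Hypothesis nth_char_perm :
  perm_eq [seq nth_char k | k <- iota 0 n] (enum C).
Implicit Types T : btree C.

Local Notation least_freq := (least_freq freq nth_char).

Definition length_unit : R := eps * L / n%:R.

Definition budget : nat := (Num.truncn (n%:R / eps) + n)%N.

Definition units (v : nat) : nat :=
  round_up length_unit budget (least_freq v)%:R.

Local Notation dp := (dp freq nth_char units (level_price bs)).

Lemma prefix_tree_weight (phi : nat -> R) T : prefix_tree T ->
  forest_weight freq phi 0 [:: T] = \sum_c (freq c)%:R * phi (depth T c).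
Proof.
move=> prefT; rewrite /forest_weight big_seq1 tree_weightE.
  by rewrite (perm_big _ prefT) big_enum.
by rewrite (perm_uniq prefT) enum_uniq.
Qed.

Lemma len_weight T : prefix_tree T ->
  (len freq T)%:R = forest_weight freq (fun d => d%:R) 0 [:: T] :> R.
Proof.
move=> /prefix_tree_weight ->; rewrite natr_sum.
by apply: eq_bigr => c _; rewrite natrM.
Qed.

Lemma decode_time_weight T : prefix_tree T ->
  decode_time freq bs T = forest_weight freq (block_cost bs) 0 [:: T].
Proof. by move/prefix_tree_weight->. Qed.

Lemma forest_leaves1 T : forest_leaves [:: T] = leaves T.
Proof. exact: cats0. Qed.

Lemma size_prefix_tree T : prefix_tree T -> size (forest_leaves [:: T]) = n.
Proof.
move=> prefT; rewrite forest_leaves1 (perm_size prefT).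
by rewrite -(perm_size nth_char_perm) size_map size_iota.
Qed.

Lemma prefix_tree_excess T : prefix_tree T ->
  (size (forest_leaves [:: T]) <= size [:: T] + n.-1)%N.
Proof. by move=> prefT; rewrite size_prefix_tree //= add1n prednK. Qed.

Lemma prefix_tree_level_cost (Q price : nat -> R) T : prefix_tree T ->
  Q 0%N = 0 -> (forall d, Q d.+1 = Q d + price d) -> (forall d, 0 <= price d) ->
  level_sum (level_cost freq nth_char price) 0 n.-1 [:: T]
  <= forest_weight freq Q 0 [:: T].
Proof.
move=> prefT Q0 Q_step price_ge0.
have uniqT : uniq (forest_leaves [:: T]).
  by rewrite forest_leaves1 (perm_uniq prefT) enum_uniq.
have := level_sum_le_weight nth_char_sorted nth_char_perm Q_step price_ge0 0
          uniqT (prefix_tree_excess prefT).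
by rewrite Q0 mul0r add0r.
Qed.

Lemma length_unit_div : 0 < L -> length_unit^-1 * L = n%:R / eps.
Proof.
by move=> L_gt0; rewrite /length_unit; field; rewrite !gt_eqF ?ltr0n.
Qed.

Lemma length_unit_budget : 0 <= L -> length_unit * budget%:R <= (1 + eps) * L.
Proof.
move=> L_ge0; have nR : 0 < n%:R :> R by rewrite ltr0n.
have -> : (1 + eps) * L = length_unit * (n%:R / eps + n%:R).
  by rewrite /length_unit; field; rewrite !gt_eqF.
rewrite ler_wpM2l //; first by rewrite divr_ge0 ?mulr_ge0 // ltW.
by rewrite natrD lerD2r truncn_le divr_ge0 // ltW.
Qed.

Lemma admissible_level_freq T : admissible freq L T ->
  level_sum (fun _ v => (least_freq v)%:R) 0 n.-1 [:: T] <= L.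
Proof.
move=> [prefT]; apply: le_trans; rewrite len_weight //.
have <- : level_cost freq nth_char (fun=> 1)
          = (fun _ v => (least_freq v)%:R : R).
  by do 2![apply/funext => ?]; rewrite /level_cost mulr1.
by apply: prefix_tree_level_cost => // d; rewrite natr1.
Qed.

(* For L = 0 the length unit vanishes; then no character below the root has a
   positive frequency. *)
Lemma admissible_units T : admissible freq L T ->
  level_sum (fun _ v => (units v)%:R) 0 n.-1 [:: T] <= budget%:R :> R.
Proof.
move=> /admissible_level_freq; set total := level_sum _ _ _ _ => le_L.
have [L_gt0|L_le0] := ltP 0 L.
  have unit_gt0 : 0 < length_unit by rewrite divr_gt0 ?mulr_gt0 // ltr0n.
  have total_le : length_unit^-1 * total <= n%:R / eps.
    by rewrite -length_unit_div // ler_wpM2l // invr_ge0 ltW.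
  have units_le v := round_up_le_div budget unit_gt0 (ler0n R (least_freq v)).
  have := level_sum_le_affine 0 n.-1 [:: T] (fun=> units_le).
  rewrite -/total => sum_le.
  have := truncnS_gt (n%:R / eps); rewrite -natr1 => budget_gt.
  have n_eq : n%:R = n.-1%:R + 1 :> R by rewrite natr1 prednK.
  by apply: le_trans sum_le _; rewrite natrD mul1r; lra.
have units_le v : (units v)%:R <= budget.+1%:R * (least_freq v)%:R + 0 :> R.
  rewrite addr0 -natrM ler_nat /units.
  case: (least_freq v) => [|f]; first by rewrite round_up0.
  by apply: leq_trans (round_up_leS _ _ _) _; rewrite leq_pmulr.
apply: le_trans (level_sum_le_affine 0 n.-1 [:: T] (fun=> units_le)) _.
rewrite mul0r addr0; apply: le_trans (ler0n _ _).
by rewrite mulr_ge0_le0 // (le_trans le_L).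
Qed.

Lemma dp_le_decode_time T : admissible freq L T ->
  costs_at_most (dp n.-1 0 n 1 budget) (decode_time freq bs T).
Proof.
move=> admT; have prefT := admT.1.
have [F] := built_of_forest freq nth_char (level_price bs)
              (prefix_tree_excess prefT) (admissible_units admT).
rewrite size_prefix_tree // => /dp_optimal.
case: dp => [[c F'] /= le_c|//]; apply: le_trans le_c _.
rewrite decode_time_weight //; apply: prefix_tree_level_cost => //.
- exact: block_cost0.
- exact: block_costS.
- exact: level_price_ge0.
Qed.

Lemma dp_tree c F : 0 <= L -> dp n.-1 0 n 1 budget = Some (c, F) ->
  exists T, [/\ F = [:: T], prefix_tree T, (len freq T)%:R <= (1 + eps) * L
              & decode_time freq bs T = c].
Proof.
move=> L_ge0 /dp_built bF.
have [T eqF] : exists T, F = [:: T].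
  by case: F bF => [|T [|? ?]] /built_size //; exists T.
rewrite {}eqF in bF *; exists T.
have prefT : prefix_tree T.
  by have := built_leaves bF; rewrite forest_leaves1 => /perm_trans; apply.
have unit_ge0 : 0 <= length_unit by rewrite divr_ge0 ?mulr_ge0 // ltW.
split=> //.
- apply: le_trans (length_unit_budget L_ge0); rewrite len_weight //.
  have := built_length unit_ge0 (fun v => @le_round_up _ _ _ _) bF (leqnn _).
  by rewrite mul0r add0r.
- rewrite decode_time_weight // (built_weight (block_costS bs_valid) bF).
  by rewrite block_cost0 // mul0r add0r.
Qed.

Lemma dp_approximates_DOPT : (exists T0, admissible freq L T0) ->
  exists c T dopt,
    [/\ dp n.-1 0 n 1 budget = Some (c, [:: T]), prefix_tree T,
        (len freq T)%:R <= (1 + eps) * L, is_DOPT freq bs L dopt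
      & decode_time freq bs T <= dopt].
Proof.
move=> exT0; have L_ge0 : 0 <= L by case: exT0 => T0 [_]; apply: le_trans.
have [dopt doptP] := exists_DOPT bs exT0.
have [[T1 admT1 timeT1] _] := doptP.
have := dp_le_decode_time admT1; rewrite timeT1.
case eq_dp: dp => [[c F]|//] /= le_c.
have [T [eqF prefT lenT timeT]] := dp_tree L_ge0 eq_dp.
by exists c, T, dopt; rewrite -eqF timeT.
Qed.

End Approximation.

(** * A timed program logic *)

Fixpoint nmods (c : cmd) : seq nat :=
  match c with
  | NSet a _ _ => [:: a]
  | Seq c1 c2 | If _ c1 c2 => nmods c1 ++ nmods c2
  | While _ c1 => nmods c1
  | _ => [::]
  end.

Fixpoint rmods (c : cmd) : seq nat :=
  match c with
  | RSet a _ _ => [:: a]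
  | Seq c1 c2 | If _ c1 c2 => rmods c1 ++ rmods c2
  | While _ c1 => rmods c1
  | _ => [::]
  end.

Fixpoint loop_free (c : cmd) : bool :=
  match c with
  | Seq c1 c2 | If _ c1 c2 => loop_free c1 && loop_free c2
  | While _ _ => false
  | _ => true
  end.

Fixpoint loop_free_time (c : cmd) : nat :=
  match c with
  | Skip => 1
  | NSet _ i e => (ncost i + ncost e).+1
  | RSet _ i e => (ncost i + rcost e).+1
  | Seq c1 c2 => loop_free_time c1 + loop_free_time c2
  | If b c1 c2 => (bcost b + (loop_free_time c1 + loop_free_time c2)).+1
  | While _ _ => 0
  end.

Section ProgramLogic.
Variable R : realType.
Implicit Types (c : cmd) (s : state R) (Q : state R -> Prop) (A B : seq nat).

(* Meaningful for loop-free commands only. *)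
Fixpoint run c s : state R :=
  match c with
  | NSet a i e => State (upd (nmem s) a (neval s i) (neval s e)) (rmem s)
  | RSet a i e => State (nmem s) (upd (rmem s) a (neval s i) (reval s e))
  | Seq c1 c2 => run c2 (run c1 s)
  | If b c1 c2 => if beval s b then run c1 s else run c2 s
  | _ => s
  end.

Definition wp c (T : nat) Q s : Prop :=
  exists t s', [/\ exec c s t s', (t <= T)%N & Q s'].

Definition agree_outside A B s s' : Prop :=
  (forall a i, a \notin A -> nmem s' a i = nmem s a i) /\
  (forall a i, a \notin B -> rmem s' a i = rmem s a i).

Definition frame c : state R -> state R -> Prop :=
  agree_outside (nmods c) (rmods c).

Lemma agree_outside_n A B s s' a i :
  agree_outside A B s s' -> a \notin A -> nmem s' a i = nmem s a i.
Proof. by case=> agree_n _; apply: agree_n. Qed.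

Lemma agree_outside_r A B s s' a i :
  agree_outside A B s s' -> a \notin B -> rmem s' a i = rmem s a i.
Proof. by case=> _ agree_r; apply: agree_r. Qed.

Lemma agree_outside_trans A B s1 s2 s3 :
  agree_outside A B s1 s2 -> agree_outside A B s2 s3 -> agree_outside A B s1 s3.
Proof.
by move=> [n12 r12] [n23 r23]; split=> a i ha; rewrite ?n23 ?n12 ?r23 ?r12.
Qed.

Lemma agree_outside_sub A B A' B' s s' :
  {subset A <= A'} -> {subset B <= B'} ->
  agree_outside A B s s' -> agree_outside A' B' s s'.
Proof.
move=> subA subB [agree_n agree_r]; split=> a i ha.
  by rewrite agree_n // (contra (subA a)).
by rewrite agree_r // (contra (subB a)).
Qed.

Lemma frame_refl c s : frame c s s.
Proof. by split. Qed.

Lemma frame_seq c1 c2 s1 s2 s3 :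
  frame c1 s1 s2 -> frame c2 s2 s3 -> frame (Seq c1 c2) s1 s3.
Proof.
move=> frame1 frame2; apply: (@agree_outside_trans _ _ _ s2).
  by apply: agree_outside_sub frame1 => a; rewrite mem_cat => ->.
by apply: agree_outside_sub frame2 => a; rewrite mem_cat orbC => ->.
Qed.

Lemma exec_frame c s t s' : exec c s t s' -> frame c s s'.
Proof.
elim=> {c s t s'} //=.
- by move=> a i e s; split=> //= a' i'; rewrite inE /upd => /negPf->.
- by move=> a i e s; split=> //= a' i'; rewrite inE /upd => /negPf->.
- by move=> c1 c2 s1 s2 s3 _ _ _ frame1 _; apply: frame_seq.
- move=> b c1 c2 s1 s2 _ _ _ frame1.
  exact: frame_seq frame1 (frame_refl c2 _).
- by move=> b c1 c2 s1 s2 _ _ _; apply: frame_seq (frame_refl c1 _).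
- by move=> b c s1 s2 s3 _ _ _ _ frame1 _; apply: agree_outside_trans.
Qed.

Lemma wp_conseq c T T' Q Q' s : wp c T Q s -> (T <= T')%N ->
  (forall s', frame c s s' -> Q s' -> Q' s') -> wp c T' Q' s.
Proof.
move=> [t [s' [ex le_t Qs']]] le_T impl; exists t, s'; split=> //.
  exact: leq_trans le_T.
exact: impl (exec_frame ex) Qs'.
Qed.

Lemma wp_le c T T' Q s : (T <= T')%N -> wp c T Q s -> wp c T' Q s.
Proof. by move=> le_T wpT; apply: wp_conseq wpT le_T _. Qed.

Lemma wp_seq c1 c2 T1 T2 Q1 Q s : wp c1 T1 Q1 s ->
  (forall s', frame c1 s s' -> Q1 s' -> wp c2 T2 Q s') ->
  wp (Seq c1 c2) (T1 + T2) Q s.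
Proof.
move=> [t1 [s1 [ex1 le1 Q1s1]]] wp2.
have [t2 [s2 [ex2 le2 Qs2]]] := wp2 s1 (exec_frame ex1) Q1s1.
by exists (t1 + t2)%N, s2; split; [apply: ExSeq ex2 | apply: leq_add |].
Qed.

Lemma wp_if b c1 c2 T Q s :
  (beval s b -> wp c1 T Q s) -> (~~ beval s b -> wp c2 T Q s) ->
  wp (If b c1 c2) (bcost b + T).+1 Q s.
Proof.
move=> wp1 wp2; case: (boolP (beval s b)) => sb.
  have [t [s' [ex le_t Qs']]] := wp1 sb; exists (bcost b + t).+1, s'.
  by split=> //; [apply: ExIfTrue | rewrite ltnS leq_add2l].
have [t [s' [ex le_t Qs']]] := wp2 sb; exists (bcost b + t).+1, s'.
by split=> //; [apply: ExIfFalse | rewrite ltnS leq_add2l].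
Qed.

Lemma exec_run c s : loop_free c ->
  exists2 t, exec c s t (run c s) & (t <= loop_free_time c)%N.
Proof.
elim: c s => //=.
- by move=> s _; exists 1%N => //; constructor.
- by move=> a i e s _; exists (ncost i + ncost e).+1 => //; constructor.
- by move=> a i e s _; exists (ncost i + rcost e).+1 => //; constructor.
- move=> c1 IH1 c2 IH2 s /andP[/(IH1 s)[t1 ex1 le1] /(IH2 (run c1 s))].
  move=> [t2 ex2 le2]; exists (t1 + t2)%N; first exact: ExSeq ex2.
  exact: leq_add.
- move=> b c1 IH1 c2 IH2 s /andP[/(IH1 s)[t1 ex1 le1] /(IH2 s)[t2 ex2 le2]].
  case: ifP => sb.
    by exists (bcost b + t1).+1; [apply: ExIfTrue | lia].
  by exists (bcost b + t2).+1; [apply: ExIfFalse; rewrite ?sb | lia].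
Qed.

Lemma wp_run c Q s : loop_free c -> Q (run c s) -> wp c (loop_free_time c) Q s.
Proof. by move=> /(exec_run s)[t ex le_t] Qs; exists t, (run c s). Qed.

Lemma run_frame c s : loop_free c -> frame c s (run c s).
Proof. by move=> /(exec_run s)[t /exec_frame]. Qed.

Definition while_time b (k T : nat) : nat := (k.+1 * (bcost b + T + 1))%N.

(* The invariant I is indexed by the variant of the loop. *)
Lemma wp_while b c T (I : nat -> state R -> Prop) k s : I k s ->
  (forall k' s', frame c s s' -> I k' s' -> beval s' b ->
     wp c T (fun s'' => exists2 k'', (k'' < k')%N & I k'' s'') s') ->
  wp (While b c) (while_time b k T)
     (fun s' => ~~ beval s' b /\ exists k', I k' s') s.
Proof.
move=> Iks body; suff loop s1 : frame c s s1 -> I k s1 -> wp (While b c)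
    (while_time b k T) (fun s' => ~~ beval s' b /\ exists k', I k' s') s1.
  exact: loop (frame_refl _ _) Iks.
elim/ltn_ind: k s1 {Iks} => k IH s1 frame1 Iks1.
have [s1b|s1b] := boolP (beval s1 b); last first.
  exists (bcost b).+1, s1; split; first exact: ExWhileFalse.
    by rewrite /while_time mulSn; lia.
  by split=> //; exists k.
have [t1 [s2 [ex1 le1 [k2 lt_k Ik2]]]] := body _ _ frame1 Iks1 s1b.
have frame2 := agree_outside_trans frame1 (exec_frame ex1).
have [t2 [s3 [ex2 le2 Qs3]]] := IH _ lt_k _ frame2 Ik2.
exists (bcost b + t1 + t2).+1, s3; split=> //; first exact: ExWhileTrue ex2.
have : (while_time b k2 T <= k * (bcost b + T + 1))%N.
  by rewrite leq_mul2r lt_k orbT.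
by rewrite {2}/while_time mulSn; lia.
Qed.

End ProgramLogic.

(* [isT] proves that the array, a numeral, is not among the modified ones. *)
Ltac trace_back :=
  repeat match goal with
  | F : frame ?c ?s ?s' |- context [nmem ?s' ?a ?i] =>
      rewrite (@agree_outside_n _ _ _ s s' a i F isT)
  | F : frame ?c ?s ?s' |- context [rmem ?s' ?a ?i] =>
      rewrite (@agree_outside_r _ _ _ s s' a i F isT)
  end.

Definition nvar (a : nat) : nexp := NGet a (NLit 0).
Definition nsucc (e : nexp) : nexp := NAdd e (NLit 1).
Definition npred (e : nexp) : nexp := NSub e (NLit 1).
Definition nassign (a : nat) (e : nexp) : cmd := NSet a (NLit 0) e.
Definition rassign (a : nat) (e : rexp) : cmd := RSet a (NLit 0) e.
Definition advance (a k : nat) : cmd := nassign a (NAdd (nvar a) (NLit k)).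

Local Notation "c1 ;; c2" := (Seq c1 c2) (at level 75, right associativity).

Definition for_test (x : nat) (e : nexp) : bexp := BNot (BLeN e (nvar x)).

Definition For (x : nat) (e : nexp) (c : cmd) : cmd :=
  nassign x (NLit 0) ;; While (for_test x e) (c ;; advance x 1).

Definition for_time (x : nat) (e : nexp) (k T : nat) : nat :=
  (loop_free_time (nassign x (NLit 0))
   + while_time (for_test x e) k (T + loop_free_time (advance x 1)))%N.

Section ForLoops.
Variable R : realType.
Implicit Types s : state R.

Definition set_var s (x v : nat) : state R :=
  State (upd (nmem s) x 0 v) (rmem s).

Lemma wp_for x e c N T (I : nat -> state R -> Prop) s :
  x \notin nmods c ->
  (forall s', frame (For x e c) s s' -> neval s' e = N) ->
  I 0 (set_var s x 0) ->
  (forall k s', (k < N)%N -> frame (For x e c) s s' -> nmem s' x 0 = k ->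
     I k s' -> wp c T (fun s'' => I k.+1 (set_var s'' x k.+1)) s') ->
  wp (For x e c) (for_time x e N T) (I N) s.
Proof.
move=> x_c eN I0 body; set body_cmd := c ;; advance x 1.
have sub_frame s1 s2 : frame body_cmd s1 s2 -> frame (For x e c) s1 s2.
  exact: frame_seq (frame_refl (nassign x (NLit 0)) _).
apply: (@wp_seq _ _ _ _ _ (fun s' => s' = set_var s x 0)).
  exact: (@wp_run _ (nassign x (NLit 0))).
move=> s1 frame0 eq_s1; have frame1 : frame (For x e c) s s1.
  exact: frame_seq frame0 (frame_refl (While (for_test x e) body_cmd) _).
pose J k s' := [/\ (k <= N)%N, nmem s' x 0 = (N - k)%N & I (N - k)%N s'].
apply: wp_conseq (wp_while (I := J) (k := N) _ _) (leqnn _) _.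
- by rewrite eq_s1 /J subnn; split=> //=; rewrite /upd !eqxx.
- move=> k s' /sub_frame/(agree_outside_trans frame1) frame' [le_k xE I_k].
  rewrite /= xE eN // -ltnNge => lt_N.
  apply: wp_seq (body _ _ lt_N frame' xE I_k) _ => s2 frame2 I_next.
  apply: wp_run => //; exists k.-1; first by lia.
  have x2E : nmem s2 x 0 = (N - k)%N by rewrite (agree_outside_n _ frame2).
  have eq_k : (N - k.-1 = (N - k).+1)%N by lia.
  rewrite /J eq_k /= x2E addn1; split=> //; first by lia.
  by rewrite /upd !eqxx.
- move=> s2 /sub_frame/(agree_outside_trans frame1) frame2.
  move=> [+ [k [le_k xE I_k]]].
  rewrite /= xE eN // negbK => le_N.
  by have <- : (N - k = N)%N by lia.
Qed.

End ForLoops.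

(** * Running times *)

Definition bigO (a b : nat) (T : nat -> nat -> nat) : Prop :=
  exists K, forall n B, (0 < n)%N -> (T n B <= K * (n ^ a * B.+1 ^ b))%N.

Lemma bigO_leq a b a' b' T :
  (a <= a')%N -> (b <= b')%N -> bigO a b T -> bigO a' b' T.
Proof.
move=> le_a le_b [K boundT]; exists K => n B n_gt0.
apply: leq_trans (boundT n B n_gt0) _.
by rewrite leq_mul2l leq_mul ?leq_pexp2l ?orbT.
Qed.

Lemma bigO_const a b k : bigO a b (fun _ _ => k).
Proof.
by exists k => n B n_gt0; rewrite leq_pmulr // muln_gt0 !expn_gt0 n_gt0.
Qed.

Lemma bigO_add a b T T' :
  bigO a b T -> bigO a b T' -> bigO a b (fun n B => T n B + T' n B)%N.
Proof.
move=> [K boundT] [K' boundT']; exists (K + K')%N => n B n_gt0.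
by rewrite mulnDl leq_add ?boundT ?boundT'.
Qed.

Lemma bigO_mul a b a' b' T T' : bigO a b T -> bigO a' b' T' ->
  bigO (a + a') (b + b') (fun n B => T n B * T' n B)%N.
Proof.
move=> [K boundT] [K' boundT']; exists (K * K')%N => n B n_gt0.
by rewrite !expnD (mulnACA (n ^ a)%N) mulnACA leq_mul ?boundT ?boundT'.
Qed.

Lemma bigO_n : bigO 1 0 (fun n _ => n).
Proof. by exists 1%N => n B _; rewrite mul1n muln1. Qed.

Lemma bigO_B : bigO 0 1 (fun _ B => B).
Proof. by exists 1%N => n B _; rewrite !mul1n leqW. Qed.

Lemma bigO_succ a b T : bigO a b T -> bigO a b (fun n B => (T n B).+1).
Proof. by move=> boundT; apply: bigO_add (bigO_const a b 1) boundT. Qed.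

Lemma bigO_while a b a' b' test N T : bigO a b N -> bigO a' b' T ->
  bigO (a + a') (b + b') (fun n B => while_time test (N n B) (T n B)).
Proof.
move=> boundN boundT; apply: bigO_mul (bigO_succ boundN) _.
apply: bigO_add; last exact: bigO_const.
by apply: bigO_add boundT; apply: bigO_const.
Qed.

Lemma bigO_for a b a' b' x e N T : bigO a b N -> bigO a' b' T ->
  bigO (a + a') (b + b') (fun n B => for_time x e (N n B) (T n B)).
Proof.
move=> boundN boundT; apply: bigO_add; first exact: bigO_const.
by apply: bigO_while boundN (bigO_add boundT _); apply: bigO_const.
Qed.

(** * Preprocessing *)

(* Names of the arrays, ending in N for natural numbers and in R for reals.
   They are abbreviations for numerals, so that footprints can be computed. *)
Local Notation inputN := 0%N (only parsing).
Local Notation freqN := 1%N (only parsing).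
Local Notation widthN := 2%N (only parsing).
Local Notation rootN := 3%N (only parsing).
Local Notation heapN := 4%N (only parsing).
Local Notation budgetN := 5%N (only parsing).
Local Notation charN := 6%N (only parsing).
Local Notation leastN := 7%N (only parsing).
Local Notation unitsN := 8%N (only parsing).
Local Notation blockN := 9%N (only parsing).
Local Notation coveredN := 10%N (only parsing).
Local Notation jstrideN := 11%N (only parsing).
Local Notation vstrideN := 12%N (only parsing).
Local Notation ustrideN := 13%N (only parsing).
Local Notation choiceN := 14%N (only parsing).
Local Notation bestN := 15%N (only parsing).
Local Notation rankN := 16%N (only parsing).
Local Notation iN := 17%N (only parsing).
Local Notation kN := 18%N (only parsing).
Local Notation uN := 19%N (only parsing).
Local Notation vN := 20%N (only parsing).
Local Notation jN := 21%N (only parsing).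
Local Notation lN := 22%N (only parsing).
Local Notation nextN := 23%N (only parsing).
Local Notation freeN := 24%N (only parsing).

Local Notation inputR := 0%N (only parsing).
Local Notation accessR := 1%N (only parsing).
Local Notation unitR := 2%N (only parsing).
Local Notation priceR := 3%N (only parsing).
Local Notation costR := 4%N (only parsing).
Local Notation bestR := 5%N (only parsing).
Local Notation descendR := 6%N (only parsing).

Definition n_ : nexp := nvar inputN.
Definition L_ : rexp := RGet inputR (NLit 0).
Definition eps_ : rexp := RGet inputR (NLit 1).
Definition B_ : nexp := nvar budgetN.
Definition unit_ : rexp := RGet unitR (NLit 0).

Definition budget_test : bexp :=
  BLeR (RMul (RNat (nsucc B_)) eps_) (RNat n_).

Definition budget_prog : cmd :=
  nassign budgetN (NLit 0) ;;
  While budget_test (advance budgetN 1) ;;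
  nassign budgetN (NAdd B_ n_).

Definition unit_prog : cmd := rassign unitR (RDiv (RMul eps_ L_) (RNat n_)).

Definition before_test : bexp :=
  BAnd (BLeN (NGet freqN (nvar kN)) (NGet freqN (nvar iN)))
       (BNot (BAnd (BLeN (NGet freqN (nvar iN)) (NGet freqN (nvar kN)))
                   (BLeN (nvar iN) (nvar kN)))).

Definition count_before : cmd := If before_test (advance rankN 1) Skip.

Definition place_char : cmd := NSet charN (nvar rankN) (nvar iN).

Definition sort_prog : cmd :=
  For iN n_ (nassign rankN (NLit 0) ;; For kN n_ count_before ;; place_char).

Definition add_term (a : nat) (e : nexp) : cmd :=
  NSet a (nsucc (nvar iN)) (NAdd (NGet a (nvar iN)) e).

Definition running_sums (a : nat) (k e : nexp) : cmd :=
  NSet a (NLit 0) (NLit 0) ;; For iN k (add_term a e).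

Definition sums_prog : cmd :=
  running_sums leastN n_ (NGet freqN (NGet charN (nvar iN))).

Definition round_step_prog : cmd :=
  If (BLeR (RNat (NGet leastN (nvar iN)))
           (RMul (RNat (NGet unitsN (nvar iN))) unit_))
     Skip
     (NSet unitsN (nvar iN) (nsucc (NGet unitsN (nvar iN)))).

Definition round_prog : cmd :=
  For iN (nsucc n_)
    (NSet unitsN (nvar iN) (NLit 0) ;; For kN (nsucc B_) round_step_prog).

(* Widths are positive, so one more block always suffices for one more level. *)
Definition price_step : cmd :=
  If (BLeN (nvar coveredN) (nvar iN))
     (RSet priceR (nvar iN) (RGet accessR (nvar blockN)) ;;
      nassign coveredN (NAdd (nvar coveredN) (NGet widthN (nvar blockN))) ;;
      advance blockN 1)
     (RSet priceR (nvar iN) (RNat (NLit 0))).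

Definition price_prog : cmd :=
  (nassign blockN (NLit 0) ;; nassign coveredN (NLit 0)) ;;
  For iN n_ price_step.

(* The machine cannot multiply natural numbers, so the multiples of the strides
   of the table are tabulated. *)
Definition strides_prog : cmd :=
  running_sums jstrideN (nsucc n_) (nsucc B_) ;;
  running_sums vstrideN (nsucc n_) (NGet jstrideN (nsucc n_)) ;;
  running_sums ustrideN (nsucc n_) (NGet vstrideN (nsucc n_)).

Lemma sum_ord_ltS n (F : 'I_n -> nat) (o : 'I_n) :
  (\sum_(i < n | i < o.+1) F i = \sum_(i < n | i < o) F i + F o)%N.
Proof.
rewrite (bigD1 o) //= addnC; congr (_ + _)%N; apply: eq_bigl => i.
by rewrite ltnS ltn_neqAle andbC.
Qed.

Section Preprocessing.
Variable R : realType.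
Implicit Types (s : state R) (n B : nat).

Definition budget_time B : nat :=
  (loop_free_time (nassign budgetN (NLit 0))
   + (while_time budget_test B (loop_free_time (advance budgetN 1))
      + loop_free_time (nassign budgetN (NAdd B_ n_))))%N.

Lemma wp_budget s n (eps : R) :
  nmem s inputN 0 = n -> rmem s inputR 1 = eps -> 0 < eps ->
  wp budget_prog (budget_time (budget n eps))
     (fun s' => nmem s' budgetN 0 = budget n eps) s.
Proof.
move=> nE epsE eps_gt0; rewrite /budget; set q := Num.truncn _.
have testE s' : frame budget_prog s s' ->
    beval s' budget_test = (nmem s' budgetN 0 < q)%N.
  move=> fr; rewrite /=; trace_back; rewrite nE epsE addn1.
  by rewrite -ler_pdivlMr // -truncn_ge_nat // divr_ge0 // ltW.
pose I k s' := (k + nmem s' budgetN 0 = q)%N.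
apply: (@wp_le _ _ (budget_time q)).
  rewrite /budget_time /while_time leq_add2l leq_add2r leq_mul2r ltnS.
  by rewrite leq_addr orbT.
apply: (@wp_seq _ _ _ _ _ (fun s' => nmem s' budgetN 0 = 0%N)).
  exact: (@wp_run _ (nassign budgetN (NLit 0))).
move=> s1 fr1 start.
have frame_test s' : frame (While budget_test (advance budgetN 1)) s1 s' ->
    frame budget_prog s s'.
  by move=> fr; apply: frame_seq fr1 (frame_seq fr (frame_refl _ _)).
apply: (@wp_seq _ _ _ _ _ (fun s' => nmem s' budgetN 0 = q)).
  apply: wp_conseq (wp_while (I := I) (k := q) _ _) (leqnn _) _.
  - by rewrite /I start addn0.
  - move=> k s2 /frame_test fr2 Ik; rewrite testE // => lt_q.
    apply: wp_run => //; exists k.-1; first by move: Ik; rewrite /I; lia.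
    by move: Ik; rewrite /I /= /upd /=; lia.
  - move=> s2 /frame_test fr2 []; rewrite testE // => ge_q [k].
    by rewrite /I; lia.
move=> s2 fr2 quotient; apply: wp_run => //=; rewrite /upd /= quotient.
by trace_back; rewrite nE.
Qed.

Definition sort_time n : nat :=
  for_time iN n_ n (loop_free_time (nassign rankN (NLit 0))
    + (for_time kN n_ n (loop_free_time count_before)
       + loop_free_time place_char))%N.

Lemma wp_rank s n (freq : 'I_n -> nat) (o : 'I_n) :
  nmem s inputN 0 = n -> (forall c : 'I_n, nmem s freqN c = freq c) ->
  nmem s iN 0 = o -> nmem s rankN 0 = 0%N ->
  wp (For kN n_ count_before) (for_time kN n_ n (loop_free_time count_before))
     (fun s' => nmem s' rankN 0 = rank freq o) s.
Proof.
move=> nE freqE iE rank0.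
pose I k s' := nmem s' rankN 0 = (\sum_(c < n | c < k) before freq c o)%N.
have rankI s' : I n s' -> nmem s' rankN 0 = rank freq o.
  by move=> ->; apply: eq_bigl => c; rewrite ltn_ord.
apply: wp_conseq (wp_for (I := I) (N := n) _ _ _ _) (leqnn _) _ => //.
- by move=> s' fr /=; trace_back.
- by rewrite /I /= /upd /= rank0 big_pred0.
- move=> k s1 lt_k fr1 kE Ik; apply: wp_run => //; pose o' := Ordinal lt_k.
  rewrite /I (sum_ord_ltS _ o') -Ik /= kE; trace_back.
  rewrite iE (freqE o') (freqE o) -/(before freq o' o).
  by case: before; rewrite /upd /= ?addn0.
- by move=> s' _; apply: rankI.
Qed.

Lemma wp_sort s n (freq : 'I_n -> nat) :
  nmem s inputN 0 = n -> (forall c : 'I_n, nmem s freqN c = freq c) ->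
  wp sort_prog (sort_time n)
     (fun s' => forall c : 'I_n, nmem s' charN (rank freq c) = c) s.
Proof.
move=> nE freqE.
pose I k s' := forall c : 'I_n, (c < k)%N -> nmem s' charN (rank freq c) = c.
apply: wp_conseq (wp_for (I := I) (N := n) _ _ _ _) (leqnn _) _ => //.
- by move=> s' fr /=; trace_back.
- move=> k s1 lt_k fr1 iE Ik; pose o := Ordinal lt_k.
  apply: (@wp_seq _ _ _ _ _ (fun s' => nmem s' rankN 0 = 0%N)).
    exact: (@wp_run _ (nassign rankN (NLit 0))).
  move=> s2 fr2 rank0; apply: wp_seq (@wp_rank _ n freq o _ _ _ rank0) _.
  + by trace_back.
  + by move=> c; trace_back.
  + by trace_back.
  move=> s3 fr3 rankE; apply: wp_run => // c; rewrite /= /upd /= rankE.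
  trace_back; rewrite iE; have [->|ne_c] := eqVneq c o; first by rewrite eqxx.
  rewrite ltnS leq_eqVlt -[k]/(val o) val_eqE (negPf ne_c) /= => lt_c.
  case: eqP => [eq_rank|_]; last by trace_back; apply: Ik.
  by case/eqP: ne_c; apply: (@rank_ord_inj _ freq); apply: val_inj.
- by move=> s' _ In c; apply: In.
Qed.

Definition running_sums_time a (k e : nexp) (N : nat) : nat :=
  (loop_free_time (NSet a (NLit 0) (NLit 0))
   + for_time iN k N (loop_free_time (add_term a e)))%N.

Lemma wp_running_sums a k e N (term : nat -> nat) s : a != iN ->
  (forall s', frame (running_sums a k e) s s' -> neval s' k = N) ->
  (forall i s', (i < N)%N -> frame (running_sums a k e) s s' ->
     nmem s' iN 0 = i -> neval s' e = term i) ->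
  wp (running_sums a k e) (running_sums_time a k e N)
     (fun s' => forall i, i <= N -> nmem s' a i = \sum_(i' < i) term i')%N s.
Proof.
move=> ne_ai kE termE.
apply: (@wp_seq _ _ _ _ _ (fun s' => nmem s' a 0 = 0%N)).
  by apply: (@wp_run _ (NSet a (NLit 0) (NLit 0))) => //=; rewrite /upd !eqxx.
move=> s1 fr1 sum0.
have frame_sums s' : frame (For iN k (add_term a e)) s1 s' ->
    frame (running_sums a k e) s s' := frame_seq fr1.
pose I m s' := forall i, (i <= m)%N -> nmem s' a i = (\sum_(i' < i) term i')%N.
apply: (wp_for (I := I)).
- by rewrite inE eq_sym.
- by move=> s' /frame_sums; apply: kE.
- by case=> // _; rewrite /= /upd (negPf ne_ai) sum0 big_ord0.
move=> m s2 lt_m /frame_sums fr2 iE Im.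
apply: wp_run => //= i le_i; rewrite /= /upd (negPf ne_ai) eqxx /= iE addn1.
case: eqP => [->|ne_i]; last by apply: Im; lia.
by rewrite big_ord_recr /= Im // (termE m).
Qed.

Definition sums_time n : nat :=
  running_sums_time leastN n_ (NGet freqN (NGet charN (nvar iN))) n.

Lemma wp_sums s n (freq : 'I_n -> nat) (nth_char : nat -> 'I_n) :
  nmem s inputN 0 = n -> (forall c : 'I_n, nmem s freqN c = freq c) ->
  (forall k, (k < n)%N -> nmem s charN k = nth_char k) ->
  wp sums_prog (sums_time n)
     (fun s' => forall v, (v <= n)%N ->
        nmem s' leastN v = least_freq freq nth_char v) s.
Proof.
move=> nE freqE charE.
apply: (@wp_running_sums _ _ _ n (fun k => freq (nth_char k))) => //=.
- by move=> s' fr; trace_back.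
- by move=> k s' lt_k fr iE; rewrite iE; trace_back; rewrite charE // freqE.
Qed.

Definition round_time n B : nat :=
  for_time iN (nsucc n_) n.+1
    (loop_free_time (NSet unitsN (nvar iN) (NLit 0))
     + for_time kN (nsucc B_) B.+1 (loop_free_time round_step_prog))%N.

Lemma wp_round s n B (delta : R) (sums : nat -> nat) :
  nmem s inputN 0 = n -> nmem s budgetN 0 = B -> rmem s unitR 0 = delta ->
  (forall v, (v <= n)%N -> nmem s leastN v = sums v) ->
  wp round_prog (round_time n B)
     (fun s' => forall v, (v <= n)%N ->
        nmem s' unitsN v = round_up delta B (sums v)%:R) s.
Proof.
move=> nE BE unitE sumsE.
pose I k s' := forall v, (v < k)%N ->
  nmem s' unitsN v = round_up delta B (sums v)%:R.
apply: (wp_for (I := I)) => //.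
  by move=> s' fr /=; trace_back; rewrite nE addn1.
move=> v s1 lt_v fr1 iE Iv.
apply: (@wp_seq _ _ _ _ _ (fun s' => I v s' /\ nmem s' unitsN v = 0%N)).
  apply: wp_run => //; split=> [w lt_w|]; rewrite /= /upd /= iE ?eqxx //.
  by case: eqP => [eq_w|_]; [lia | apply: Iv].
move=> s2 fr2 [Iv2 units0].
pose J k s' := I v s' /\
  nmem s' unitsN v = iter k (round_step delta (sums v)%:R) 0%N.
apply: wp_conseq (wp_for (I := J) (N := B.+1) _ _ _ _) (leqnn _) _ => //.
- by move=> s' fr /=; trace_back; rewrite BE addn1.
- move=> k s3 lt_k fr3 kE [Iv3 unitsE]; apply: wp_run => //.
  rewrite /J iterS -unitsE /round_step /=; trace_back.
  rewrite iE unitE (sumsE v); last by rewrite -ltnS.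
  case: ifP => _; rewrite /= ?addn0; split=> // [w lt_w|].
  + by rewrite /= /upd /=; case: eqP => [eq_w|_]; [lia | apply: Iv3].
  + by rewrite /= /upd /= eqxx addn1.
- move=> s3 _ [Iv3 unitsE] w.
  by rewrite ltnS leq_eqVlt => /predU1P[->//|]; apply: Iv3.
Qed.

Definition price_time n : nat :=
  (loop_free_time (nassign blockN (NLit 0) ;; nassign coveredN (NLit 0))
   + for_time iN n_ n (loop_free_time price_step))%N.

Lemma wp_price s n (bs : scheme R) :
  nmem s inputN 0 = n -> (forall h, nmem s widthN h = nth 0%N (unzip1 bs) h) ->
  (forall h, rmem s accessR h = nth 0 (unzip2 bs) h) ->
  wp price_prog (price_time n)
     (fun s' => forall d, (d < n)%N -> rmem s' priceR d = level_price bs d) s.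
Proof.
move=> nE widthE accessE.
pose I k s' := [/\ nmem s' blockN 0 = blocks_used bs k,
  nmem s' coveredN 0 = width_upto bs (blocks_used bs k) &
  forall d, (d < k)%N -> rmem s' priceR d = level_price bs d].
apply: (@wp_seq _ _ _ _ _
  (fun s' => nmem s' blockN 0 = 0%N /\ nmem s' coveredN 0 = 0%N)).
  exact: wp_run.
move=> s1 fr1 [block0 covered0].
apply: wp_conseq (wp_for (I := I) (N := n) _ _ _ _) (leqnn _) _ => //.
- by move=> s' fr /=; trace_back.
- by split=> //=; rewrite /upd /= covered0 width_upto0.
- move=> k s2 lt_k fr2 iE [blockE coveredE pricesE]; apply: wp_run => //.
  have width2E h : nmem s2 widthN h = nth 0%N (unzip1 bs) h by trace_back.
  have access2E h : rmem s2 accessR h = nth 0 (unzip2 bs) h by trace_back.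
  have priced d : (d < k.+1)%N -> d != k -> rmem s2 priceR d = level_price bs d.
    by rewrite ltnS leq_eqVlt => /predU1P[->/eqP//|lt_d _]; apply: pricesE.
  rewrite /I /= iE coveredE; case: ifP => covered.
    split=> [||d lt_d]; rewrite /= /upd /= ?blockE ?addn1 //.
      by rewrite width_uptoS width2E.
    case: eqP => [->|/eqP ne_d]; last exact: priced.
    by rewrite /level_price covered access2E.
  split=> [||d lt_d]; rewrite /= /upd //=.
  case: eqP => [->|/eqP ne_d]; last exact: priced.
  by rewrite /level_price covered.
- by move=> s' _ [].
Qed.

Definition strides_time n : nat :=
  (running_sums_time jstrideN (nsucc n_) (nsucc B_) n.+1
   + (running_sums_time vstrideN (nsucc n_) (NGet jstrideN (nsucc n_)) n.+1
      + running_sums_time ustrideN (nsucc n_) (NGet vstrideN (nsucc n_))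
          n.+1))%N.

Definition strides n B s : Prop :=
  forall k, (k <= n.+1)%N ->
    [/\ nmem s jstrideN k = k * B.+1, nmem s vstrideN k = k * (n.+1 * B.+1)
      & nmem s ustrideN k = k * (n.+1 * (n.+1 * B.+1))]%N.

Lemma wp_strides s n B :
  nmem s inputN 0 = n -> nmem s budgetN 0 = B ->
  wp strides_prog (strides_time n) (strides n B) s.
Proof.
move=> nE BE.
have sumE k m : (\sum_(i < k) m = k * m)%N by rewrite sum_nat_const card_ord.
apply: wp_seq (@wp_running_sums _ _ _ n.+1 (fun=> B.+1) _ _ _ _) _ => //=.
- by move=> s' fr; trace_back; rewrite nE addn1.
- by move=> k s' _ fr _; trace_back; rewrite BE addn1.
move=> s1 fr1 jstrideE; apply: wp_seq (@wp_running_sums _ _ _ n.+1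
  (fun=> n.+1 * B.+1)%N _ _ _ _) _ => //=.
- by move=> s' fr; trace_back; rewrite nE addn1.
- by move=> k s' _ fr _; trace_back; rewrite nE addn1 jstrideE // sumE.
move=> s2 fr2 vstrideE; apply: wp_conseq (@wp_running_sums _ _ _ n.+1
  (fun=> n.+1 * (n.+1 * B.+1))%N _ _ _ _) (leqnn _) _ => //=.
- by move=> s' fr; trace_back; rewrite nE addn1.
- by move=> k s' _ fr _; trace_back; rewrite nE addn1 vstrideE // sumE.
move=> s3 fr3 ustrideE k le_k; split; last by rewrite ustrideE // sumE.
- by trace_back; rewrite jstrideE // sumE.
- by trace_back; rewrite vstrideE // sumE.
Qed.

End Preprocessing.

(** * Filling the table *)

Definition cell_exp (u v j l : nexp) : nexp :=
  NAdd (NAdd (NAdd (NGet ustrideN u) (NGet vstrideN v)) (NGet jstrideN j)) l.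

Definition here_exp : nexp := cell_exp (nvar uN) (nvar vN) (nvar jN) (nvar lN).

Definition leaf_exp : nexp :=
  cell_exp (nvar uN) (npred (nvar vN)) (npred (nvar jN)) (nvar lN).

Definition descend_exp : nexp :=
  cell_exp (npred (nvar uN)) (nvar vN) (NAdd (nvar jN) (nvar jN))
           (NSub (nvar lN) (NGet unitsN (nvar vN))).

Definition try_leaf : cmd :=
  If (BLeN (NLit 1) (NGet choiceN leaf_exp))
     (nassign bestN (NLit 1) ;; rassign bestR (RGet costR leaf_exp))
     Skip.

Definition descend_test : bexp :=
  BAnd (BLeN (NLit 1) (nvar uN))
    (BAnd (BLeN (NAdd (nvar jN) (nvar jN)) (nvar vN))
      (BAnd (BLeN (NGet unitsN (nvar vN)) (nvar lN))
            (BLeN (NLit 1) (NGet choiceN descend_exp)))).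

Definition descend_cost : rexp :=
  RAdd (RGet costR descend_exp)
    (RMul (RNat (NGet leastN (nvar vN)))
          (RGet priceR (NSub n_ (nsucc (nvar uN))))).

Definition keep_cheapest : cmd :=
  If (BAnd (BLeN (NLit 1) (nvar bestN))
           (BLeR (RGet bestR (NLit 0)) (RGet descendR (NLit 0))))
     Skip
     (nassign bestN (NLit 2) ;; rassign bestR (RGet descendR (NLit 0))).

Definition try_descend : cmd :=
  If descend_test (rassign descendR descend_cost ;; keep_cheapest) Skip.

Definition reset_best : cmd :=
  nassign bestN (NLit 0) ;; rassign bestR (RNat (NLit 0)).

Definition cell_prog : cmd :=
  reset_best ;;
  If (BLeN (nvar vN) (NLit 0))
     (If (BLeN (nvar jN) (NLit 0)) (nassign bestN (NLit 3)) Skip)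
     (If (BLeN (nvar jN) (NLit 0)) Skip (try_leaf ;; try_descend)).

Definition write_prog : cmd :=
  NSet choiceN here_exp (nvar bestN) ;;
  RSet costR here_exp (RGet bestR (NLit 0)).

Definition table_prog : cmd :=
  For uN n_ (For vN (nsucc n_) (For jN (nsucc n_) (For lN (nsucc B_)
    (cell_prog ;; write_prog)))).

Lemma radix_ltn (m a b a' b' : nat) :
  (a < a')%N -> (b < m)%N -> (a * m + b < a' * m + b')%N.
Proof.
move=> lt_a lt_b; have : (a.+1 * m <= a' * m)%N by rewrite leq_mul2r lt_a orbT.
by rewrite mulSn; lia.
Qed.

Lemma radix_inj (m a b a' b' : nat) : (b < m)%N -> (b' < m)%N ->
  (a * m + b = a' * m + b')%N -> a = a' /\ b = b'.
Proof.
move=> lt_b lt_b' eq_ab; have m_gt0 : (0 < m)%N by apply: leq_ltn_trans lt_b.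
split; last by have := congr1 (modn^~ m) eq_ab; rewrite !modnMDl !modn_small.
by have := congr1 (divn^~ m) eq_ab; rewrite !divnMDl // !divn_small // !addn0.
Qed.

(* 0 stands for an infeasible state, 1 for a leaf put on the current level, 2
   for a descent to the next level and 3 for a completed forest. *)
Definition choice_code (R : realDomainType) (C : finType) (p : plan R C)
    : nat :=
  match p with
  | None => 0
  | Some (_, Leaf _ :: _) => 1
  | Some (_, Node _ _ :: _) => 2
  | Some (_, [::]) => 3
  end.

Section Table.
Variables (R : realType) (n B : nat) (freq : 'I_n -> nat).
Variables (nth_char : nat -> 'I_n) (units : nat -> nat) (price : nat -> R).
Implicit Types (s : state R) (p q : plan R 'I_n) (u v j l : nat).

Local Notation least_freq := (least_freq freq nth_char).

Definition cell_plan u v j l : plan R 'I_n :=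
  dp freq nth_char units price u (n - u.+1)%N v j l.

Definition address u v j l : nat :=
  (((u * n.+1 + v) * n.+1 + j) * B.+1 + l)%N.

Definition in_table u v j l : bool :=
  [&& u < n, v <= n, j <= n & l <= B]%N.

Definition at_state s u v j l : Prop :=
  [/\ nmem s uN 0 = u, nmem s vN 0 = v, nmem s jN 0 = j & nmem s lN 0 = l].

Definition best s p : Prop :=
  nmem s bestN 0 = choice_code p /\ rmem s bestR 0 = plan_cost p.

Definition entry s (a : nat) p : Prop :=
  nmem s choiceN a = choice_code p /\ rmem s costR a = plan_cost p.

Definition table_filled s (X : nat) : Prop :=
  forall u v j l, in_table u v j l -> (address u v j l < X)%N ->
    entry s (address u v j l) (cell_plan u v j l).

Record env s : Prop := Env {
  env_n : nmem s inputN 0 = n;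
  env_B : nmem s budgetN 0 = B;
  env_least : forall v, (v <= n)%N -> nmem s leastN v = least_freq v;
  env_units : forall v, (v <= n)%N -> nmem s unitsN v = units v;
  env_price : forall d, (d < n)%N -> rmem s priceR d = price d;
  env_strides : strides n B s
}.

Definition env_arrays : seq nat :=
  [:: inputN; budgetN; leastN; unitsN; jstrideN; vstrideN; ustrideN].

Lemma env_frame c s s' : frame c s s' ->
  all [predC nmods c] env_arrays -> priceR \notin rmods c -> env s -> env s'.
Proof.
move=> [agree_n agree_r] /allP kept price_kept.
have keepE a i : a \in env_arrays -> nmem s' a i = nmem s a i.
  by move/kept/agree_n.
case=> nE BE leastE unitsE priceE stridesE.
split=> [||v le_v|v le_v|d lt_d|k le_k]; rewrite ?keepE ?agree_r //.
- exact: leastE.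
- exact: unitsE.
- exact: priceE.
- exact: stridesE.
Qed.

Lemma table_filled_frame c s s' X : frame c s s' ->
  choiceN \notin nmods c -> costR \notin rmods c ->
  table_filled s X -> table_filled s' X.
Proof.
move=> [agree_n agree_r] choice_kept cost_kept filled u v j l inT lt_X.
by rewrite /entry agree_n // agree_r //; apply: filled.
Qed.

Lemma address_inj u v j l u' v' j' l' : in_table u v j l ->
  in_table u' v' j' l' -> address u v j l = address u' v' j' l' ->
  [/\ u = u', v = v', j = j' & l = l'].
Proof.
move=> /and4P[_ le_v le_j le_l] /and4P[_ le_v' le_j' le_l'].
by case/(@radix_inj B.+1) => // /(@radix_inj n.+1)[] // /(@radix_inj n.+1)[].
Qed.

Lemma address_leaf u v j l : (0 < v)%N -> (0 < j)%N -> (l <= B)%N ->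
  (address u v.-1 j.-1 l < address u v j l)%N.
Proof.
move=> v_gt0 j_gt0 le_l; apply: radix_ltn; last by rewrite ltnS.
by rewrite -addnS prednK // leq_add2r leq_mul2r leq_add2l leq_pred orbT.
Qed.

Lemma address_descend u v j l l' : (0 < u)%N -> (j.*2 <= n)%N -> (l' <= B)%N ->
  (address u.-1 v j.*2 l' < address u v j l)%N.
Proof.
move=> u_gt0 le_j le_l; apply: radix_ltn; last by rewrite ltnS.
apply: radix_ltn; last by rewrite ltnS.
by rewrite -{2}(prednK u_gt0) mulSn; lia.
Qed.

Lemma address_end u v j l : in_table u v j l ->
  (address u v j l < address n 0 0 0)%N.
Proof. by move=> /and4P[lt_u le_v le_j le_l]; do 3 apply: radix_ltn => //. Qed.

Lemma cell_expE s eu ev ej el u v j l : env s ->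
  neval s eu = u -> neval s ev = v -> neval s ej = j -> neval s el = l ->
  (u <= n.+1)%N -> (v <= n.+1)%N -> (j <= n.+1)%N ->
  neval s (cell_exp eu ev ej el) = address u v j l.
Proof.
move=> /env_strides stridesE /= -> -> -> -> le_u le_v le_j.
have [_ _ ->] := stridesE u le_u; have [_ -> _] := stridesE v le_v.
have [-> _ _] := stridesE j le_j.
by rewrite /address !mulnDl !mulnA.
Qed.

Lemma here_expE s u v j l : env s -> at_state s u v j l -> in_table u v j l ->
  neval s here_exp = address u v j l.
Proof.
by move=> es [uE vE jE lE] /and4P[? ? ? ?]; apply: cell_expE => //; lia.
Qed.

Lemma leaf_expE s u v j l : env s -> at_state s u v j l -> in_table u v j l ->
  neval s leaf_exp = address u v.-1 j.-1 l.
Proof.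
move=> es [uE vE jE lE] /and4P[? ? ? ?].
by apply: cell_expE; rewrite /= ?uE ?vE ?jE ?lE ?subn1 //; lia.
Qed.

Lemma descend_expE s u v j l : env s -> at_state s u v j l ->
  in_table u v j l -> (j.*2 <= n)%N ->
  neval s descend_exp = address u.-1 v j.*2 (l - units v).
Proof.
move=> es [uE vE jE lE] /and4P[? ? ? ?] ?.
apply: cell_expE; rewrite //= ?uE ?vE ?jE ?lE ?subn1 ?addnn //; try lia.
by rewrite (env_units es).
Qed.

Lemma choice_code_gt0 p : (0 < choice_code p)%N = isSome p.
Proof. by case: p => [[c [|[]]]|]. Qed.

Lemma run_try_leaf s k p : best s None -> entry s (neval s leaf_exp) p ->
  best (run try_leaf s) (add_leaf nth_char k p).
Proof.
move=> [best_n best_r] [entry_n entry_r].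
have -> : run try_leaf s =
    if isSome p then
      State (upd (nmem s) bestN 0 1%N)
            (upd (rmem s) bestR 0 (rmem s costR (neval s leaf_exp)))
    else s by rewrite -choice_code_gt0 -entry_n.
by rewrite entry_r; case: p {entry_n entry_r} => [[c F]|].
Qed.

Lemma run_keep_cheapest s p q : best s p -> rmem s descendR 0 = plan_cost q ->
  choice_code q = 2 -> best (run keep_cheapest s) (cheapest p q).
Proof.
move=> [best_n best_r] desc code_q.
have -> : run keep_cheapest s =
    if isSome p && (plan_cost p <= plan_cost q) then s
    else State (upd (nmem s) bestN 0 2)
               (upd (rmem s) bestR 0 (rmem s descendR 0)).
  by rewrite -choice_code_gt0 -best_n -best_r -desc.
case: q code_q desc => [[c' F']|//] code_q desc.
case: p best_n best_r => [[c F]|] best_n best_r /=; last first.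
  by split; rewrite //= /upd.
by case: ifP => _; split; rewrite //= /upd.
Qed.

Lemma run_try_descend s d u v j l p q : env s -> at_state s u v j l ->
  in_table u v j l -> d = (n - u.+1)%N -> (0 < j)%N -> best s p ->
  (can_descend units u v j l ->
     entry s (neval s descend_exp) q /\
     forall c F, q = Some (c, F) -> size F = j.*2) ->
  best (run try_descend s)
    (cheapest p (if can_descend units u v j l then
                   add_level freq nth_char price d v q else None)).
Proof.
move=> es [uE vE jE lE] /and4P[lt_u le_v _ _] -> j_gt0 best_s entry_q.
have -> : run try_descend s =
    if can_descend units u v j l && (0 < nmem s choiceN (neval s descend_exp))%N
    then run keep_cheapest
           (State (nmem s) (upd (rmem s) descendR 0 (reval s descend_cost)))
    else s.
  by rewrite /can_descend -(env_units es) // -uE -vE -jE -lE -addnn -!andbA.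
have cheapest_None : cheapest p None = p by case: (p) => [[]|].
case: can_descend entry_q => [/(_ isT)[[entry_n entry_r] size_q]|_]; last first.
  by rewrite cheapest_None.
rewrite entry_n choice_code_gt0.
case: q entry_n entry_r size_q => [[c F]|]; last by rewrite cheapest_None.
move=> _ entry_r /(_ _ _ erefl) sizeF.
apply: (@run_keep_cheapest _ _ (add_level _ _ _ _ _ (Some (c, F)))) => //.
  rewrite /upd /= -[rmem s costR _]/(rmem s costR (neval s descend_exp)).
  rewrite entry_r.
  by rewrite uE vE (env_n es) addn1 (env_least es) // (env_price es) //; lia.
by case: F sizeF {entry_r} => [|? [|? ?]] //=; case: j j_gt0 {jE}.
Qed.

Lemma wp_cell s u v j l : in_table u v j l -> env s -> at_state s u v j l ->
  table_filled s (address u v j l) ->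
  wp cell_prog (loop_free_time cell_prog)
     (fun s' => best s' (cell_plan u v j l)) s.
Proof.
move=> inT es at_s filled; apply: wp_run => //.
set s1 := run reset_best s.
have fr1 : frame reset_best s s1 by apply: run_frame.
have best1 : best s1 None by [].
have es1 : env s1 by apply: env_frame fr1 _ _ es.
have at1 : at_state s1 u v j l by [].
have filled1 : table_filled s1 (address u v j l).
  exact: table_filled_frame fr1 _ _ filled.
have -> : run cell_prog s =
    if (v <= 0)%N then
      if (j <= 0)%N then run (nassign bestN (NLit 3)) s1 else s1
    else if (j <= 0)%N then s1 else run try_descend (run try_leaf s1).
  by have [_ v1E j1E _] := at1; rewrite -v1E -j1E.
case: (and4P inT) => lt_u le_v le_j le_l; rewrite /cell_plan.
case: v j inT at1 filled1 le_v le_j {at_s filled} => [|v] [|j];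
  try by case: (u).
move=> inT at1 filled1 le_v le_j; rewrite dpSS; set s2 := run try_leaf s1.
have fr2 : frame try_leaf s1 s2 by apply: run_frame.
have es2 : env s2 by apply: env_frame fr2 _ _ es1.
have at2 : at_state s2 u v.+1 j.+1 l by rewrite /at_state; trace_back.
apply: (run_try_descend es2 at2) => //.
  apply: run_try_leaf => //; rewrite (leaf_expE es1 at1 inT).
  by apply: filled1; [rewrite /in_table; lia | apply: address_leaf].
move=> /and3P[u_gt0 le_j2 le_unit]; split; last by move=> c F /dp_size.
rewrite (descend_expE es2 at2 inT) /entry; last by lia.
trace_back; have -> : (n - u.+1).+1 = (n - u.-1.+1)%N by lia.
apply: filled1; first by rewrite /in_table; lia.
by apply: address_descend; lia.
Qed.

Lemma wp_table_step s u v j l : in_table u v j l -> env s ->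
  at_state s u v j l -> table_filled s (address u v j l) ->
  wp (cell_prog ;; write_prog)
     (loop_free_time cell_prog + loop_free_time write_prog)
     (fun s' => table_filled s' (address u v j l).+1) s.
Proof.
move=> inT es at_s filled.
apply: wp_seq (wp_cell inT es at_s filled) _ => s1 fr1 [best_n best_r].
have es1 : env s1 by apply: env_frame fr1 _ _ es.
have at1 : at_state s1 u v j l by rewrite /at_state; trace_back.
have filled1 : table_filled s1 (address u v j l).
  exact: table_filled_frame fr1 _ _ filled.
apply: wp_run => //.
have -> : run write_prog s1 =
  State (upd (nmem s1) choiceN (neval s1 here_exp) (nmem s1 bestN 0))
        (upd (rmem s1) costR (neval s1 here_exp) (rmem s1 bestR 0)) by [].
rewrite (here_expE es1 at1 inT) best_n best_r => u' v' j' l' inT'.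
rewrite ltnS leq_eqVlt /entry /= /upd !eqxx /= => /predU1P[eq_a|lt_a].
  by have [-> -> -> ->] := address_inj inT' inT eq_a; rewrite eqxx.
by rewrite (ltn_eqF lt_a); apply: filled1.
Qed.

Definition table_time : nat :=
  for_time uN n_ n (for_time vN (nsucc n_) n.+1 (for_time jN (nsucc n_) n.+1
    (for_time lN (nsucc B_) B.+1
      (loop_free_time cell_prog + loop_free_time write_prog)))).

Lemma wp_table s : env s ->
  wp table_prog table_time (fun s' => table_filled s' (address n 0 0 0)) s.
Proof.
move=> es.
apply: (wp_for (I := fun k s' => table_filled s' (address k 0 0 0))) => //.
  by move=> s' fr /=; trace_back; apply: env_n.
move=> u s1 lt_u fr1 uE filled1.
have es1 : env s1 by apply: env_frame fr1 _ _ es.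
have -> : address u.+1 0 0 0 = address u n.+1 0 0.
  by rewrite /address mulSn; lia.
apply: (wp_for (I := fun k s' => table_filled s' (address u k 0 0))) => //.
  by move=> s' fr /=; trace_back; rewrite (env_n es) addn1.
move=> v s2 lt_v fr2 vE filled2.
have es2 : env s2 by apply: env_frame fr2 _ _ es1.
have -> : address u v.+1 0 0 = address u v n.+1 0.
  by rewrite /address !addnS mulSn; lia.
apply: (wp_for (I := fun k s' => table_filled s' (address u v k 0))) => //.
  by move=> s' fr /=; trace_back; rewrite (env_n es) addn1.
move=> j s3 lt_j fr3 jE filled3.
have es3 : env s3 by apply: env_frame fr3 _ _ es2.
have -> : address u v j.+1 0 = address u v j B.+1.
  by rewrite /address !addnS mulSn; lia.
apply: (wp_for (I := fun k s' => table_filled s' (address u v j k))) => //.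
  by move=> s' fr /=; trace_back; rewrite (env_B es) addn1.
move=> l s4 lt_l fr4 lE filled4.
have es4 : env s4 by apply: env_frame fr4 _ _ es3.
have at4 : at_state s4 u v j l by rewrite /at_state; trace_back.
have := wp_table_step _ es4 at4 filled4; rewrite -addnS; apply.
by rewrite /in_table; lia.
Qed.

End Table.

(** * Reading off the tree *)

Definition walk_test : bexp :=
  BAnd (BLeN (NLit 1) (NGet choiceN here_exp))
       (BLeN (NGet choiceN here_exp) (NLit 2)).

Definition walk_leaf : cmd :=
  NSet heapN (nvar nextN) (NLit 0) ;;
  NSet heapN (nsucc (nvar nextN)) (NGet charN (npred (nvar vN))) ;;
  advance nextN 3 ;;
  nassign vN (npred (nvar vN)) ;;
  nassign jN (npred (nvar jN)).

(* The nodes are written in breadth-first order into records of size 3, so the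
   children of the nodes of a level are the next free records. *)
Definition write_node : cmd :=
  NSet heapN (nvar nextN) (NLit 1) ;;
  NSet heapN (nsucc (nvar nextN)) (nvar freeN) ;;
  NSet heapN (NAdd (nvar nextN) (NLit 2)) (NAdd (nvar freeN) (NLit 3)) ;;
  advance freeN 6 ;;
  advance nextN 3.

Definition next_level : cmd :=
  nassign lN (NSub (nvar lN) (NGet unitsN (nvar vN))) ;;
  nassign uN (npred (nvar uN)) ;;
  nassign jN (NAdd (nvar jN) (nvar jN)).

Definition walk_descend : cmd := For iN (nvar jN) write_node ;; next_level.

Definition leaf_test : bexp := BLeN (NGet choiceN here_exp) (NLit 1).

Definition walk_body : cmd := If leaf_test walk_leaf walk_descend.

Definition walk_init : cmd :=
  nassign rootN (NLit 0) ;;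
  nassign uN (npred n_) ;;
  nassign vN n_ ;;
  nassign jN (NLit 1) ;;
  nassign lN B_ ;;
  nassign nextN (NLit 0) ;;
  nassign freeN (NLit 3).

Definition walk_prog : cmd := walk_init ;; While walk_test walk_body.

Fixpoint stored_from (n : nat) (M : nat -> nat) (p : nat)
    (F : seq (btree 'I_n)) : Prop :=
  if F is T :: F' then stored M (3 * p) T /\ stored_from M p.+1 F' else True.

Definition node_stored (M : nat -> nat) (p q : nat) : Prop :=
  [/\ M (3 * p) = 1, M (3 * p).+1 = 3 * q & M (3 * p).+2 = 3 * q.+1]%N.

Lemma stored_pair_up n (M : nat -> nat) p q m (F : seq (btree 'I_n)) :
  size F = m.*2 ->
  (forall k, (k < m)%N -> node_stored M (p + k) (q + k.*2)) ->
  stored_from M q F -> stored_from M p (pair_up F).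
Proof.
elim: m p q F => [|m IH] p q [|T1 [|T2 F]] //= [sizeF] nodes [M1 [M2 MF]].
split; last first.
  apply: (IH p.+1 q.+2) => // k lt_k.
  by have := nodes k.+1 lt_k; rewrite addnS addSn doubleS !addnS !addSn.
by have := nodes 0%N isT; rewrite !addn0 => -[-> -> ->].
Qed.

Section Walk.
Variables (R : realType) (n B : nat) (freq : 'I_n -> nat).
Variables (nth_char : nat -> 'I_n) (units : nat -> nat) (price : nat -> R).
Implicit Types (s : state R) (u v j l p : nat) (F : seq (btree 'I_n)).

Local Notation cell_plan := (cell_plan freq nth_char units price).
Local Notation env := (env B freq nth_char units price).
Local Notation in_table := (in_table n B).

Lemma wp_walk_leaf s u v j l p c :
  at_state s u v.+1 j.+1 l ->
  nmem s nextN 0 = (3 * p)%N -> nmem s charN v = c ->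
  wp walk_leaf (loop_free_time walk_leaf)
     (fun s' => [/\ at_state s' u v j l, nmem s' nextN 0 = 3 * p.+1,
        nmem s' heapN (3 * p) = 0, nmem s' heapN (3 * p).+1 = c &
        forall X, X < 3 * p -> nmem s' heapN X = nmem s heapN X])%N s.
Proof.
move=> [uE vE jE lE] nextE charE; apply: wp_run => //.
rewrite /at_state /= /upd /= nextE vE jE !subn1 /= charE addn1 mulnS addnC.
split=> //.
- by rewrite ltn_eqF // eqxx.
- by rewrite eqxx.
- by move=> X lt_X; rewrite !ltn_eqF // ltnW // ltnS ltnW.
Qed.

Definition level_written s s' p q j : Prop :=
  (forall X, X < 3 * p -> nmem s' heapN X = nmem s heapN X)%N /\
  (forall k, k < j -> node_stored (nmem s' heapN) (p + k) (q + k.*2))%N.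

Lemma wp_write_level s p q j : nmem s jN 0 = j ->
  nmem s nextN 0 = (3 * p)%N -> nmem s freeN 0 = (3 * q)%N ->
  wp (For iN (nvar jN) write_node)
     (for_time iN (nvar jN) j (loop_free_time write_node))
     (fun s' => [/\ nmem s' nextN 0 = 3 * (p + j),
        nmem s' freeN 0 = 3 * (q + j.*2) & level_written s s' p q j])%N s.
Proof.
move=> jE nextE freeE.
apply: (wp_for (I := fun m s' => [/\ nmem s' nextN 0 = 3 * (p + m),
  nmem s' freeN 0 = 3 * (q + m.*2) & level_written s s' p q m])%N) => //.
- by move=> s' fr /=; trace_back.
- by split; rewrite //= /upd /= addn0.
move=> m s1 lt_m fr1 iE [next1E free1E [old1 new1]]; apply: wp_run => //.
rewrite /level_written /node_stored /= /upd /= next1E free1E; split; try lia.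
split=> [X lt_X|k]; first by rewrite -old1 // !ifF //; lia.
rewrite ltnS leq_eqVlt => /predU1P[->|lt_k].
  by split; rewrite ?eqxx; repeat case: eqP => ?; lia.
by have [-> -> ->] := new1 k lt_k; split; rewrite ?ifF //; lia.
Qed.

Definition descend_time : nat :=
  (for_time iN (nvar jN) n (loop_free_time write_node)
   + loop_free_time next_level)%N.

Lemma wp_walk_descend s u v j l p : env s -> in_table u.+1 v j l ->
  at_state s u.+1 v j l ->
  nmem s nextN 0 = (3 * p)%N -> nmem s freeN 0 = (3 * (p + j))%N ->
  wp walk_descend descend_time
     (fun s' => [/\ at_state s' u v j.*2 (l - units v),
        nmem s' nextN 0 = 3 * (p + j), nmem s' freeN 0 = 3 * (p + j + j.*2)
        & level_written s s' p (p + j) j])%N s.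
Proof.
move=> es /and4P[_ le_v le_j _] [uE vE jE lE] nextE freeE.
apply: (@wp_le _ _ (for_time iN (nvar jN) j (loop_free_time write_node)
                    + loop_free_time next_level)%N).
  by rewrite leq_add2r leq_add2l leq_mul2r ltnS le_j orbT.
apply: wp_seq (wp_write_level jE nextE freeE) _.
move=> s1 fr1 [next1E free1E written].
apply: wp_run => //; rewrite /at_state /level_written /= /upd /=; split=> //.
by trace_back; rewrite uE vE jE lE (env_units es) // subn1 addnn.
Qed.

(* The records from number p on are still to be written; however they are
   completed to the planned forest, the heap will hold the tree T. *)
Variant walk_inv (T : btree 'I_n) (k : nat) s : Prop :=
  WalkInv u v j l c F p of k = (u + v)%N & in_table u v j l & at_state s u v j l
    & nmem s nextN 0 = (3 * p)%N & nmem s freeN 0 = (3 * (p + j))%N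
    & cell_plan u v j l = Some (c, F)
    & forall M, (forall X, (X < 3 * p)%N -> M X = nmem s heapN X) ->
        stored_from M p F -> stored M 0 T.

Definition ready s : Prop :=
  [/\ env s, table_filled B freq nth_char units price s (address n B n 0 0 0)
    & forall k, (k < n)%N -> nmem s charN k = nth_char k].

Lemma ready_frame c s s' : frame c s s' ->
  all [predC nmods c] (env_arrays ++ [:: choiceN; charN]) ->
  all [predC rmods c] [:: priceR; costR] -> ready s -> ready s'.
Proof.
move=> fr; rewrite all_cat /= => /and4P[env_kept choice_kept char_kept _].
move=> /and3P[price_kept cost_kept _] [es filled charE]; split.
- exact: env_frame fr _ _ es.
- exact: table_filled_frame fr _ _ filled.
- by move=> k lt_k; rewrite (agree_outside_n _ fr) ?charE.
Qed.

Lemma here_choiceE s u v j l :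
  ready s -> at_state s u v j l -> in_table u v j l ->
  neval s (NGet choiceN here_exp) = choice_code (cell_plan u v j l).
Proof.
move=> [es filled _] at_s inT.
rewrite -[LHS]/(nmem s choiceN (neval s here_exp)) (here_expE es at_s inT).
by have [] := filled u v j l inT (address_end inT).
Qed.

Lemma walk_testE s u v j l :
  ready s -> at_state s u v j l -> in_table u v j l ->
  beval s walk_test = (0 < choice_code (cell_plan u v j l) <= 2)%N.
Proof. by move=> rdy at_s inT; rewrite -(here_choiceE rdy at_s inT). Qed.

Lemma leaf_testE s u v j l :
  ready s -> at_state s u v j l -> in_table u v j l ->
  beval s leaf_test = (choice_code (cell_plan u v j l) <= 1)%N.
Proof. by move=> rdy at_s inT; rewrite -(here_choiceE rdy at_s inT). Qed.

Definition step_time : nat :=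
  (bcost leaf_test + (loop_free_time walk_leaf + descend_time)).+1.

Lemma wp_walk_body T k s : ready s -> walk_inv T k s -> beval s walk_test ->
  wp walk_body step_time
     (fun s' => exists2 k', (k' < k)%N & walk_inv T k' s') s.
Proof.
move=> rdy [u v j l c F p -> inT at_s nextE freeE eq_plan heap_T].
have [es _ charE] := rdy; have leafE := leaf_testE rdy at_s inT.
rewrite (walk_testE rdy at_s inT); rewrite eq_plan in leafE *.
move: eq_plan leafE inT at_s freeE heap_T; rewrite /cell_plan.
case: dpP => //; first by move=> -> -> [_ <-].
- move=> v' j' c' F' -> -> eq_plan [_ <-] leafE inT at_s freeE heap_T _.
  apply: wp_if => [_|]; last by rewrite leafE.
  have lt_v : (v' < n)%N by case/and4P: inT.
  apply: wp_conseq (wp_walk_leaf at_s nextE (charE _ lt_v)) (leq_addr _ _) _.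
  move=> s' fr [at_s' next_s' tag_s' char_s' old].
  exists (u + v')%N; first by rewrite addnS.
  apply: (WalkInv (p := p.+1) _ _ at_s' next_s' _ eq_plan) => //.
  + by move: inT; rewrite /in_table; lia.
  + by trace_back; rewrite freeE addSnnS.
  move=> M M_old stored_F'; apply: heap_T => /=.
    by move=> X lt_X; rewrite M_old ?old //; lia.
  by rewrite !M_old ?tag_s' ?char_s' //; lia.
- move=> u' c' F' -> j_gt0 le_jv le_unit eq_plan [_ <-].
  move=> leafE inT at_s freeE heap_T _.
  have sizeF' := dp_size eq_plan.
  have code2 : choice_code (Some (c, pair_up F')) = 2.
    have : (1 < size F')%N by lia.
    by case: (F') => [|? [|? ?]].
  apply: wp_if; rewrite leafE code2 // => _.
  apply: wp_conseq (wp_walk_descend es inT at_s nextE freeE) (leq_addl _ _) _.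
  move=> s' fr [at_s' next_s' free_s' [old new]].
  exists (u' + v)%N; first by rewrite addSn.
  have lt_u : (u'.+1 < n)%N by case/and4P: inT.
  apply: (WalkInv (c := c') (F := F') _ _ at_s' next_s' free_s') => //.
  + by move: inT; rewrite /in_table; lia.
  + by rewrite -eq_plan /cell_plan; congr dp; lia.
  move=> M M_old stored_F'; apply: heap_T.
    by move=> X lt_X; rewrite M_old ?old //; lia.
  apply: stored_pair_up sizeF' _ stored_F' => i lt_i.
  have [tag_i left_i right_i] := new i lt_i.
  by split; rewrite M_old ?tag_i ?left_i ?right_i //; lia.
Qed.

Definition walk_time : nat :=
  (loop_free_time walk_init + while_time walk_test (n + n) step_time)%N.

Lemma wp_walk s : (0 < n)%N -> ready s ->
  wp walk_prog walk_time
     (fun s' => forall c T,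
        cell_plan n.-1 n 1 B = Some (c, [:: T]) -> output s' T) s.
Proof.
move=> n_gt0 rdy.
apply: wp_seq (@wp_run _ walk_init (eq^~ (run walk_init s)) _ isT (erefl _)) _.
move=> s1 fr1 eq_s1; have rdy1 : ready s1 by apply: ready_frame fr1 _ _ rdy.
have at_s1 : at_state s1 n.-1 n 1 B.
  have [es _ _] := rdy.
  by rewrite /at_state eq_s1 /= /upd /= (env_n es) (env_B es) subn1.
have inT : in_table n.-1 n 1 B by rewrite /in_table; lia.
have root1 : nmem s1 rootN 0 = 0%N by rewrite eq_s1.
case eq_plan: (cell_plan n.-1 n 1 B) => [[c F]|]; last first.
  exists (bcost walk_test).+1, s1; split=> //; apply: ExWhileFalse.
  by rewrite (walk_testE rdy1 at_s1 inT) eq_plan.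
have [T eq_F] : exists T, F = [:: T].
  by case: F eq_plan => [|T [|? ?]] /dp_size //; exists T.
rewrite {}eq_F in eq_plan *.
have inv1 : walk_inv T (n.-1 + n) s1.
  apply: (WalkInv (p := 0) _ _ at_s1 _ _ eq_plan) => //; try by rewrite eq_s1.
  by move=> M _ [].
apply: wp_conseq (wp_while inv1 _) _ _.
- move=> k s2 fr2; apply: wp_walk_body.
  exact: ready_frame fr2 _ _ rdy1.
- by rewrite leq_mul2r ltnS leq_add2r leq_pred orbT.
move=> s2 fr2 [stop [k inv2]] _ _ [_ <-].
case: inv2 => u v j l c' F' p _ inT2 at_s2 _ _ eq_plan2 heap_T.
have rdy2 : ready s2 by apply: ready_frame fr2 _ _ rdy1.
rewrite /output; trace_back; rewrite root1; apply: heap_T => //.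
move: stop; rewrite (walk_testE rdy2 at_s2 inT2) eq_plan2.
by case: F' {eq_plan2} => [|[]].
Qed.

End Walk.

(** * The algorithm *)

Definition prep_prog : cmd :=
  budget_prog ;; unit_prog ;; sort_prog ;; sums_prog ;; round_prog ;;
  price_prog ;; strides_prog.

Definition prep_time n B : nat :=
  (budget_time B + (loop_free_time unit_prog + (sort_time n + (sums_time n
   + (round_time n B + (price_time n + strides_time n))))))%N.

Definition main_prog : cmd := prep_prog ;; table_prog ;; walk_prog.

Definition main_time n B : nat :=
  (prep_time n B + (table_time n B + walk_time n))%N.

Lemma nth_map_enum_ord (V : Type) (x0 : V) n (f : 'I_n -> V) (c : 'I_n) :
  nth x0 [seq f c | c <- enum 'I_n] c = f c.
Proof. by rewrite (nth_map c) ?size_enum_ord // nth_ord_enum. Qed.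

Section Correctness.
Variables (R : realType) (n : nat) (freq : 'I_n -> nat) (bs : scheme R).
Variables (L eps : R).
Hypotheses (n_gt0 : (0 < n)%N) (eps_gt0 : 0 < eps).

Let nth_char := by_freq freq (Ordinal n_gt0).
Let unit_count := units freq n nth_char L eps.
Let B := budget n eps.

Lemma wp_prep :
  wp prep_prog (prep_time n B)
     (fun s => env B freq nth_char unit_count (level_price bs) s
               /\ forall k, (k < n)%N -> nmem s charN k = nth_char k)
     (input freq bs L eps).
Proof.
set s0 := input freq bs L eps; have nE : nmem s0 inputN 0 = n by [].
have freqE (c : 'I_n) : nmem s0 freqN c = freq c by apply: nth_map_enum_ord.
apply: wp_seq (wp_budget nE (erefl eps) eps_gt0) _; rewrite -/B => s1 fr1 BE.
apply: wp_seq (@wp_run _ unit_prog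
  (fun s' => rmem s' unitR 0 = length_unit n L eps) _ isT _) _.
  by rewrite /= /upd /=; trace_back.
move=> s2 fr2 unitE; apply: wp_seq (@wp_sort _ _ n freq _ _) _.
- by trace_back.
- by move=> c; trace_back.
move=> s3 fr3 rankE.
have charE k : (k < n)%N -> nmem s3 charN k = nth_char k.
  by move=> lt_k; rewrite -{1}(by_freqK freq (Ordinal n_gt0) lt_k) rankE.
apply: wp_seq (@wp_sums _ _ n freq nth_char _ _ charE) _.
- by trace_back.
- by move=> c; trace_back.
move=> s4 fr4 leastE.
apply: wp_seq (@wp_round _ _ n B (length_unit n L eps) _ _ _ _ leastE) _;
  try by trace_back.
move=> s5 fr5 unitsE; apply: wp_seq (@wp_price _ _ n bs _ _ _) _;
  try by [trace_back | move=> h; trace_back].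
move=> s6 fr6 priceE.
apply: wp_conseq (@wp_strides _ _ n B _ _) (leqnn _) _; try by trace_back.
move=> s7 fr7 stridesE; split; last by move=> k lt_k; trace_back; apply: charE.
split=> [||v le_v|v le_v|d lt_d|//]; trace_back => //.
- exact: leastE.
- exact: unitsE.
- exact: priceE.
Qed.

Lemma wp_main :
  wp main_prog (main_time n B)
     (fun s => forall c T,
        dp freq nth_char unit_count (level_price bs) n.-1 0 n 1 B
        = Some (c, [:: T]) -> output s T)
     (input freq bs L eps).
Proof.
apply: wp_seq wp_prep _ => s1 fr1 [es1 charE].
apply: wp_seq (wp_table es1) _ => s2 fr2 filled.
have rdy2 : ready B freq nth_char unit_count (level_price bs) s2.
  split=> //; first by apply: env_frame fr2 _ _ es1.
  by move=> k lt_k; trace_back; apply: charE.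
apply: wp_conseq (wp_walk n_gt0 rdy2) (leqnn _) _ => s3 _.
by rewrite /cell_plan prednK // subnn.
Qed.

End Correctness.

Lemma bigO_running_sums a k e N :
  bigO 1 0 N -> bigO 1 0 (fun n B => running_sums_time a k e (N n B)).
Proof.
move=> boundN; apply: bigO_add; first exact: bigO_const.
exact: (bigO_for _ _ boundN (bigO_const 0 0 _)).
Qed.

Lemma bigO_budget_time : bigO 0 1 (fun _ B => budget_time B).
Proof.
apply: bigO_add; first exact: bigO_const.
apply: bigO_add; last exact: bigO_const.
exact: (bigO_while _ bigO_B (bigO_const 0 0 _)).
Qed.

Lemma bigO_sort_time : bigO 2 0 (fun n _ => sort_time n).
Proof.
apply: (bigO_for _ _ bigO_n); apply: bigO_add; first exact: bigO_const.
apply: bigO_add; last exact: bigO_const.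
exact: (bigO_for _ _ bigO_n (bigO_const 0 0 _)).
Qed.

Lemma bigO_sums_time : bigO 1 0 (fun n _ => sums_time n).
Proof. exact: bigO_running_sums bigO_n. Qed.

Lemma bigO_round_time : bigO 1 1 round_time.
Proof.
apply: (bigO_for _ _ (bigO_succ bigO_n)).
apply: bigO_add; first exact: bigO_const.
exact: (bigO_for _ _ (bigO_succ bigO_B) (bigO_const 0 0 _)).
Qed.

Lemma bigO_price_time : bigO 1 0 (fun n _ => price_time n).
Proof.
apply: bigO_add; first exact: bigO_const.
exact: (bigO_for _ _ bigO_n (bigO_const 0 0 _)).
Qed.

Lemma bigO_strides_time : bigO 1 0 (fun n _ => strides_time n).
Proof.
have bound_succ := bigO_succ bigO_n.
apply: bigO_add; first exact: bigO_running_sums.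
by apply: bigO_add; apply: bigO_running_sums.
Qed.

Lemma bigO_table_time : bigO 3 1 table_time.
Proof.
apply: (bigO_for _ _ bigO_n); do 2 apply: (bigO_for _ _ (bigO_succ bigO_n)).
exact: (bigO_for _ _ (bigO_succ bigO_B) (bigO_const 0 0 _)).
Qed.

Lemma bigO_step_time : bigO 1 0 (fun n _ => step_time n).
Proof.
apply/bigO_succ/bigO_add; first exact: bigO_const.
apply: bigO_add; first exact: bigO_const.
apply: bigO_add; last exact: bigO_const.
exact: (bigO_for _ _ bigO_n (bigO_const 0 0 _)).
Qed.

Lemma bigO_walk_time : bigO 2 0 (fun n _ => walk_time n).
Proof.
apply: bigO_add; first exact: bigO_const.
exact: (bigO_while _ (bigO_add bigO_n bigO_n) bigO_step_time).
Qed.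

Lemma bigO_prep_time : bigO 2 1 prep_time.
Proof.
apply: bigO_add; first exact: bigO_leq bigO_budget_time.
apply: bigO_add; first exact: bigO_const.
apply: bigO_add; first exact: bigO_leq bigO_sort_time.
apply: bigO_add; first exact: bigO_leq bigO_sums_time.
apply: bigO_add; first exact: bigO_leq bigO_round_time.
apply: bigO_add; first exact: bigO_leq bigO_price_time.
exact: bigO_leq bigO_strides_time.
Qed.

Lemma bigO_main_time : bigO 3 1 main_time.
Proof.
apply: bigO_add; first exact: bigO_leq bigO_prep_time.
by apply: bigO_add; [exact: bigO_table_time | exact: bigO_leq bigO_walk_time].
Qed.

Lemma budget_le (R : realType) n (eps : R) : (0 < n)%N -> 0 < eps ->
  (budget n eps).+1%:R <= 3 * (n%:R / Num.min 1 eps).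
Proof.
move=> n_gt0 eps_gt0; have n_ge1 : 1 <= n%:R :> R by rewrite ler1n.
have min_gt0 : 0 < Num.min 1 eps by rewrite lt_min ltr01.
have trunc_le : (Num.truncn (n%:R / eps))%:R <= n%:R / eps.
  by rewrite truncn_le divr_ge0 // ltW.
have div_eps : n%:R / eps <= n%:R / Num.min 1 eps.
  by rewrite ler_wpM2l // lef_pV2 ?posrE // ge_min lexx orbT.
have div_1 : n%:R <= n%:R / Num.min 1 eps.
  by rewrite ler_peMr // invf_ge1 // ge_min lexx.
by rewrite /budget -addn1 !natrD; lra.
Qed.

Lemma main_time_le : exists K, forall (R : realType) n (eps : R),
  (0 < n)%N -> 0 < eps ->
  (main_time n (budget n eps))%:R <= K%:R * (n%:R ^+ 4 / Num.min 1 eps) :> R.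
Proof.
have [K time_le] := bigO_main_time; exists (K * 3)%N => R n eps n_gt0 eps_gt0.
have := time_le n (budget n eps) n_gt0.
rewrite -(ler_nat R) => /le_trans; apply.
rewrite expn1 natrM [(_ * _.+1)%:R]natrM natrX natrM -mulrA ler_wpM2l //.
have -> : 3 * (n%:R ^+ 4 / Num.min 1 eps)
          = n%:R ^+ 3 * (3 * (n%:R / Num.min 1 eps)) :> R by ring.
by rewrite ler_wpM2l ?exprn_ge0 // budget_le.
Qed.

Theorem theorem2 :
  exists (P : cmd) (K : nat),
  forall (R : realType) (n : nat) (freq : 'I_n -> nat) (bs : scheme R)
    (L eps : R),
    (0 < n)%N -> valid_scheme bs -> long_enough 'I_n bs -> 0 < eps ->
    exists (t : nat) (s : state R),
      [/\ exec P (input freq bs L eps) t s,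
          t%:R <= K%:R * (n%:R ^+ 4 / Num.min 1 eps) :> R
        & (exists T0 : btree 'I_n, admissible freq L T0) ->
          exists (T : btree 'I_n) (dopt : R),
            [/\ output s T,
                prefix_tree T,
                (len freq T)%:R <= (1 + eps) * L,
                is_DOPT freq bs L dopt
              & decode_time freq bs T <= dopt] ].
Proof.
have [K time_le] := main_time_le.
exists main_prog, K => R n freq bs L eps n_gt0 bs_valid _ eps_gt0.
have [t [s [ex le_t out]]] := wp_main freq bs L n_gt0 eps_gt0.
exists t, s; split=> // [|exT0].
  by apply: le_trans (time_le R n eps n_gt0 eps_gt0); rewrite ler_nat.
have [c [T [dopt [eq_plan prefT lenT doptP le_dopt]]]] :=
  dp_approximates_DOPT n_gt0 bs_valid eps_gt0
    (@by_freq_sorted _ freq _) (by_freq_perm freq (Ordinal n_gt0)) exT0.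
by exists T, dopt; split=> //; apply: out eq_plan.
Qed.
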